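(* Let $\Delta>0$ and $\alpha\in(0,1/2)$. For every integer $m\ge 1$, $$C_m^{\mathrm{post}}(\alpha,\Delta)=m\,C_1(\alpha,\Delta),$$ where $C_1(\alpha,\Delta)$ is the optimal symmetric average sample size of $\alpha$-correct randomized sequential tests for one Gaussian stream, and $C_m^{\mathrm{post}}(\alpha,\Delta)$ is the optimal symmetric average sample complexity of $m$-coordinate adaptive procedures with coordinatewise error at most $\alpha$.
   Context: One-coordinate problem. The unknown sign is $\sigma\in\{-1,+1\}$ and the observations $Z_n\sim N(\sigma\Delta,1)$, $n\ge1$, are independent; $\mathbb P_\sigma$ and $\mathbb E_\sigma$ (also written $\mathbb P_\pm,\mathbb E_\pm$) denote probability and expectation when the true sign is $\sigma$. A randomized sequential test consists of a stopping time $\nu$ and a terminal decision $\widehat\sigma\in\{-1,+1\}$; here $\nu$ is a stopping time for the filtration generated by the successive observations $Z_1,Z_2,\dots$ together with internal randomization that is independent of the observations and whose law does not depend on $\sigma$, and $\widehat\sigma$ is measurable with respect to the history stopped at $\nu$. The test is $\alpha$-correct if $\mathbb P_+(\widehat\sigma=-1)\le\alpha$ and $\mathbb P_-(\widehat\sigma=+1)\le\alpha$. Define $$C_1(\alpha,\Delta)=\inf\tfrac12\bigl(\mathbb E_+[\nu]+\mathbb E_-[\nu]\bigr),$$ the infimum being over all $\alpha$-correct randomized sequential tests. $m$-coordinate problem. The unknown parameter is $\sigma=(\sigma_1,\dots,\sigma_m)\in\{-1,+1\}^m$; $\mathbb P_\sigma$ and $\mathbb E_\sigma$ denote probability and expectation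 under $\sigma$. At each time $t=1,2,\dots$, before the next observation is drawn, a sampling rule chooses $A_t\in\{1,\dots,m\}$ using the past observations and parameter-independent internal randomization. Conditional on the past and on $A_t$, the next observation satisfies $Y_t\sim N(\sigma_{A_t}\Delta,1)$, and the observations are conditionally independent across times. Let $\tau$ be a stopping time (with respect to the history of internal randomization, choices and observations) that is almost surely finite under every $\sigma$, and let $S$ be any random element measurable with respect to the history stopped at $\tau$. For each $j\in\{1,\dots,m\}$ there is a measurable decoder $d_j$ giving $\widehat\sigma_j=d_j(S)\in\{-1,+1\}$. A procedure consists of the sampling rule, $\tau$, $S$ and the decoders $d_1,\dots,d_m$. Coordinatewise error control is the requirement $$\sup_{\sigma\in\{-1,+1\}^m}\mathbb P_\sigma(\widehat\sigma_j\ne\sigma_j)\le\alpha,\qquad j=1,\dots,m.$$ Define $$C_m^{\mathrm{post}}(\alpha,\Delta)=\inf 2^{-m}\sum_{\sigma\in\{-1,+1\}^m}\mathbb E_\sigma[\tau],$$ the infimum being over all procedures satisfying coordinatewise error control. *)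

(* Defs.v *)
From HB Require Import structures.
From mathcomp Require Import all_boot all_order all_algebra.
From mathcomp Require Import finmap.
From mathcomp Require Import all_classical all_reals all_analysis.

Set Implicit Arguments.
Unset Strict Implicit.
Unset Printing Implicit Defensive.
Import Order.TTheory GRing.Theory Num.Theory.
Local Open Scope classical_set_scope.
Local Open Scope ring_scope.

(* Signs are encoded by booleans: true is +1 and false is -1. *)
Definition sgnb (R : realType) (b : bool) : R := if b then 1 else -1.

Section sigma_algebras.
Context {T : Type}.

Definition sigma_of d (S : measurableType d) (f : T -> S) : set_system T :=
  preimage_set_system setT f measurable.

(* None is the value +oo. *)
Definition le_time (o : option nat) (n : nat) : bool :=
  if o is Some k then (k <= n)%N else false.

(* F n is the information available after n observations; stopping before the
   first observation is allowed. *)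
Definition stopping_time (F : nat -> set_system T) (tau : T -> option nat) :=
  forall n, F n [set w | le_time (tau w) n].

Definition stopped (F : nat -> set_system T) (tau : T -> option nat) :
    set_system T :=
  [set B | <<s \bigcup_n F n >> B /\
           forall n, F n (B `&` [set w | le_time (tau w) n])].

Definition measurable_wrt (G : set_system T) d (S : measurableType d)
    (f : T -> S) :=
  sigma_of f `<=` G.

End sigma_algebras.

Definition enat (R : realType) (o : option nat) : \bar R :=
  if o is Some k then (k%:R)%:E else +oo%E.

Definition mean_time (R : realType) d (T : measurableType d)
    (P : probability T R) (tau : T -> option nat) : \bar R :=
  (\int[P]_w enat R (tau w))%E.

Definition mutually_independent (R : realType) d (T : measurableType d)
    (P : probability T R) (I : choiceType) (G : I -> set_system T) :=
  forall (J : {fset I}) (B : I -> set T), (forall i, i \in J -> G i (B i)) ->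
    P (\bigcap_(i in [set` J]) B i) = (\big[*%E/1%E]_(i <- J) P (B i))%E.

Definition hist1 (T : Type) (R : realType) dU (E : measurableType dU)
    (U : T -> E) (Z : nat -> T -> R) (n : nat) : set_system T :=
  <<s sigma_of U `|` \bigcup_(i in `I_n) sigma_of (Z i) >>.

(* The probability spaces carrying the tests are arbitrary; U is the internal
   randomization and Z n is the (n+1)-st observation. *)
Record seq_test (R : realType) (Delta : R) := SeqTest {
  st_disp : measure_display ;
  st_T : measurableType st_disp ;
  st_P : bool -> probability st_T R ;
  st_dispU : measure_display ;
  st_E : measurableType st_dispU ;
  st_U : st_T -> st_E ;
  st_Z : nat -> st_T -> R ;
  st_nu : st_T -> option nat ;
  st_dec : st_T -> bool ;
  st_mU : measurable_fun setT st_U ;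
  st_mZ : forall n, measurable_fun setT (st_Z n) ;
  st_lawU : forall B, measurable B ->
    st_P true (st_U @^-1` B) = st_P false (st_U @^-1` B) ;
  st_lawZ : forall s n B, measurable B ->
    st_P s (st_Z n @^-1` B) = normal_prob (sgnb R s * Delta) 1 B ;
  st_indep : forall s, mutually_independent (st_P s)
    (fun k : option nat => if k is Some n then sigma_of (st_Z n)
                           else sigma_of st_U) ;
  st_stop : stopping_time (hist1 st_U st_Z) st_nu ;
  st_mdec : measurable_wrt (stopped (hist1 st_U st_Z) st_nu) st_dec }.

Arguments st_P {R Delta} p _ : rename.
Arguments st_nu {R Delta} p _ : rename.
Arguments st_dec {R Delta} p _ : rename.

Definition correct1 (R : realType) (Delta alpha : R) (p : seq_test Delta) :=
  (st_P p true [set w | st_dec p w = false] <= alpha%:E)%E /\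
  (st_P p false [set w | st_dec p w = true] <= alpha%:E)%E.

Definition cost1 (R : realType) (Delta : R) (p : seq_test Delta) : \bar R :=
  ((2^-1)%:E * (mean_time (st_P p true) (st_nu p) +
                mean_time (st_P p false) (st_nu p)))%E.

Definition C1 (R : realType) (alpha Delta : R) : \bar R :=
  ereal_inf [set x | exists p : seq_test Delta, correct1 alpha p /\ x = cost1 p].

Definition histm (T : Type) (R : realType) m dU (E : measurableType dU)
    (U : T -> E) (A : nat -> T -> 'I_m) (Y : nat -> T -> R) (n : nat) :
    set_system T :=
  <<s sigma_of U `|` \bigcup_(i in `I_n)
        (preimage_set_system setT (A i) [set: set 'I_m] `|` sigma_of (Y i)) >>.

(* A t and Y t are the (t+1)-st choice and observation.  The randomization used
   over all rounds is collected in the single random element U.  Since A t is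
   measurable for the history before Y t, pp_lawY is the conditional law of Y t
   given the randomization, all previous observations and all choices up to and
   including A t. *)
Record procedure (R : realType) (m : nat) (Delta : R) := Procedure {
  pp_disp : measure_display ;
  pp_T : measurableType pp_disp ;
  pp_P : {ffun 'I_m -> bool} -> probability pp_T R ;
  pp_dispU : measure_display ;
  pp_E : measurableType pp_dispU ;
  pp_U : pp_T -> pp_E ;
  pp_A : nat -> pp_T -> 'I_m ;
  pp_Y : nat -> pp_T -> R ;
  pp_tau : pp_T -> option nat ;
  pp_dispS : measure_display ;
  pp_SS : measurableType pp_dispS ;
  pp_S : pp_T -> pp_SS ;
  pp_d : 'I_m -> pp_SS -> bool ;
  pp_mU : measurable_fun setT pp_U ;
  pp_mY : forall t, measurable_fun setT (pp_Y t) ;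
  pp_lawU : forall s s' B, measurable B ->
    pp_P s (pp_U @^-1` B) = pp_P s' (pp_U @^-1` B) ;
  pp_rule : forall t k, histm pp_U pp_A pp_Y t [set w | pp_A t w = k] ;
  pp_lawY : forall s t F B, histm pp_U pp_A pp_Y t F -> measurable B ->
    pp_P s (F `&` pp_Y t @^-1` B) =
    (\int[pp_P s]_(w in F)
       normal_prob (sgnb R (s (pp_A t w)) * Delta)%R 1%R B)%E ;
  pp_stop : stopping_time (histm pp_U pp_A pp_Y) pp_tau ;
  pp_fin : forall s, {ae pp_P s, forall w, pp_tau w <> None} ;
  pp_mS : measurable_wrt (stopped (histm pp_U pp_A pp_Y) pp_tau) pp_S ;
  pp_md : forall j, measurable_fun setT (pp_d j) }.

Arguments pp_P {R m Delta} p _ : rename.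
Arguments pp_tau {R m Delta} p _ : rename.
Arguments pp_S {R m Delta} p _ : rename.
Arguments pp_d {R m Delta} p _ _ : rename.

Definition coordinatewise_correct (R : realType) m (Delta alpha : R)
    (p : procedure m Delta) :=
  forall j : 'I_m,
    (ereal_sup [set pp_P p s [set w | pp_d p j (pp_S p w) <> s j]
               | s in [set: {ffun 'I_m -> bool}]] <= alpha%:E)%E.

Definition costm (R : realType) m (Delta : R) (p : procedure m Delta) :
    \bar R :=
  ((2 ^- m)%:E *
   \sum_(s : {ffun 'I_m -> bool}) mean_time (pp_P p s) (pp_tau p))%E.

Definition Cpost (R : realType) (m : nat) (alpha Delta : R) : \bar R :=
  ereal_inf [set x | exists p : procedure m Delta,
                       coordinatewise_correct alpha p /\ x = costm p].

(* Main.v *)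
Require Import Defs.
From mathcomp Require Import all_boot all_order all_algebra.
From mathcomp Require Import finmap.
From mathcomp Require Import all_classical all_reals all_analysis.
From mathcomp Require Import measurable_realfun.
From mathcomp Require Import zify ring lra.
Import Order.TTheory GRing.Theory Num.Theory.
Import numFieldNormedType.Exports.
Local Open Scope classical_set_scope.
Local Open Scope ring_scope.

Set Implicit Arguments.
Unset Strict Implicit.
Unset Printing Implicit Defensive.

(* Upper bound.  Run a one-stream test of finite cost on the coordinates one after the
   other, on the product of m copies of its probability space; stage k+1 is
   appended to the first k stages on a binary product, where the conditional law
   of each observation is read off the sections of a history event.

   Lower bound.  Fix a procedure, a coordinate j and the signs of the other
   coordinates, and view the rounds in which j is sampled as a test of sigma_j.
   Colour each round by whether j is sampled (alternating the colours after the
   stopping time, so that both colours occur infinitely often).  The noise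
   variables listed colour by colour are i.i.d. and independent of the
   randomization, so the off-colour list can serve as randomization of the test
   while the other list supplies its observations.  Before the procedure stops,
   its history is a function of that randomization and of the observations used
   so far, whence the number of samples of j is a stopping time of the test.
   Error control is uniform in sigma, so every such test is alpha-correct, and
   summing over j and averaging over sigma gives m * C1 <= cost. *)

(** * Sigma-algebras, stopping times and histories *)

(** The procedure itself decides which rounds carry which colour, so the independence of the two
    noise lists is not a matter of grouping coordinates. It rests on predictability: a colour is
    known before the noise of its round is drawn. A process with constant expectation turns this
    into a product formula, and recurrence of both colours permits the passage to the limit. Another
    obstacle is that noise is an observation minus a mean depending on the sign under test, while a
    test has a single family of random variables for its two laws. The sign is therefore made a
    component of the sample point. It does not leak into the randomization: standard noise has the
    same law under both signs. Since the other signs are frozen, off-arm observations made before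
    stopping are recovered from their noise without knowledge of the tested sign. Finally, a test
    may run forever with positive probability and a procedure may not. This is why only tests of
    finite cost are strung together, and why decisions receive a fixed value where no stopping
    occurs. *)

Section sigma_closure.
Context {T : Type} {G : set_system T} (sG : sigma_algebra setT G).

Lemma sigma_set0 : G set0. Proof. by case: sG. Qed.

Lemma sigma_setC A : G A -> G (~` A).
Proof. by case: sG => _ + _ GA => /(_ _ GA); rewrite setTD. Qed.

Lemma sigma_setT : G setT.
Proof. by rewrite -setC0; apply: sigma_setC; exact: sigma_set0. Qed.

Lemma sigma_bigcup (A : (set T)^nat) :
  (forall n, G (A n)) -> G (\bigcup_n A n).
Proof. by case: sG => _ _; exact. Qed.

Lemma sigma_setU A B : G A -> G B -> G (A `|` B).
Proof.
by move=> GA GB; rewrite -bigcup2E; apply: sigma_bigcup => -[|[|n]]//=;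
  exact: sigma_set0.
Qed.

Lemma sigma_setI A B : G A -> G B -> G (A `&` B).
Proof.
move=> GA GB; rewrite -(setCK (A `&` B)) setCI.
by apply: sigma_setC; apply: sigma_setU; exact: sigma_setC.
Qed.

Lemma sigma_setD A B : G A -> G B -> G (A `\` B).
Proof. by move=> GA GB; rewrite setDE; apply: sigma_setI => //; exact: sigma_setC. Qed.

Lemma sigma_cst (P : Prop) : G [set _ | P].
Proof.
have [p|np] := pselect P.
  rewrite (_ : [set _ | P] = setT); first exact: sigma_setT.
  by apply/seteqP; split.
rewrite (_ : [set _ | P] = set0); first exact: sigma_set0.
by apply/seteqP; split.
Qed.

Lemma sigma_countable_union (I : countType) (A : I -> set T) :
  (forall i, G (A i)) -> G [set w | exists i, A i w].
Proof.
move=> GA.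
rewrite (_ : mkset _ = \bigcup_n (if choice.unpickle n is Some i then A i else set0)).
  apply: sigma_bigcup => n; case: (choice.unpickle n) => [i|]; first exact: GA.
  exact: sigma_set0.
apply/seteqP; split => w /=.
  by move=> [i Aiw]; exists (choice.pickle i) => //; rewrite choice.pickleK.
by move=> [n _]; case: (choice.unpickle n) => // i Aiw; exists i.
Qed.

Lemma sigma_countable_inter (I : countType) (A : I -> set T) :
  (forall i, G (A i)) -> G [set w | forall i, A i w].
Proof.
move=> GA.
rewrite (_ : mkset _ = ~` [set w | exists i, (~` A i) w]).
  by apply: sigma_setC; apply: sigma_countable_union => i; exact: sigma_setC.
apply/seteqP; split => w /=; first by move=> Aw [i]; exact.
by move=> Nw i; apply: contrapT => NAi; apply: Nw; exists i.
Qed.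

(** Reduces a random index (the sampled arm, a slot, a stopping time) to a fixed one, since
    countably many pieces make up the event. *)
Lemma sigma_split (I : countType) (f : T -> I) (A : set T) :
  (forall i, G (A `&` [set w | f w = i])) -> G A.
Proof.
move=> GA; rewrite (_ : A = [set w | exists i, (A `&` [set w | f w = i]) w]).
  exact: sigma_countable_union.
by apply/seteqP; split => w /=; [move=> Aw; exists (f w)|case=> i []].
Qed.

(** Good-sets principle on a restricted event: a generated sigma-algebra is transported along [f],
    inside [D], by treating its generators only. Complements are taken relative to [D], so [D] must
    belong to [G]. *)
Lemma sigma_trace T' (f : T -> T') (D : set T) : G D ->
  sigma_algebra setT [set F : set T' | G (f @^-1` F `&` D)].
Proof.
move=> GD; split => /=.
- by rewrite preimage_set0 set0I; exact: sigma_set0.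
- move=> A GA; rewrite setTD.
  rewrite (_ : _ `&` _ = D `\` (f @^-1` A `&` D)); first exact: sigma_setD.
  by apply/seteqP; split => w /=; [case=> NA Dw; split => // -[] |
     case=> Dw NA; split => // Aw; exact: NA].
- move=> A GA; rewrite preimage_bigcup setI_bigcupl.
  exact: sigma_bigcup.
Qed.

End sigma_closure.

Lemma measurable_sigma_algebra d (T : measurableType d) :
  sigma_algebra setT (@measurable d T).
Proof.
split; first exact: measurable0.
  by move=> A mA; rewrite setTD; exact: measurableC.
by move=> A mA; exact: bigcup_measurable.
Qed.

Section stopping_times.
Context {T : Type} (F : nat -> set_system T) (tau : T -> option nat).
Hypothesis sF : forall n, sigma_algebra setT (F n).
Hypothesis ndF : forall n, F n `<=` F n.+1.
Hypothesis tauF : stopping_time F tau.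

Lemma filtration_le m n : (m <= n)%N -> F m `<=` F n.
Proof.
move=> /subnKC <-; elim: (n - m)%N => [|k ih]; first by rewrite addn0.
by rewrite addnS => A /ih; exact: ndF.
Qed.

Lemma stopped_at n : F n [set w | tau w = Some n].
Proof.
have := tauF n; case: n => [|n] tn.
  rewrite (_ : mkset _ = [set w | le_time (tau w) 0])//.
  apply/seteqP; split => w /=; first by move=> ->.
  by case: (tau w) => //= k; rewrite leqn0 => /eqP ->.
rewrite (_ : mkset _ = [set w | le_time (tau w) n.+1] `\` [set w | le_time (tau w) n]).
  by apply: sigma_setD => //; apply: ndF.
apply/seteqP; split => w /=; first by move=> ->/=; rewrite leqnn ltnn.
case: (tau w) => [k|] /= [+ /negP]; rewrite // -ltnNge => k1 k2.
by congr Some; apply/eqP; rewrite eqn_leq k1 k2.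
Qed.

Lemma not_stopped n : F n [set w | ~~ le_time (tau w) n].
Proof.
rewrite (_ : mkset _ = ~` [set w | le_time (tau w) n]).
  exact: sigma_setC.
by apply/seteqP; split => w /= /negP.
Qed.

Lemma stopped_sigma_algebra : sigma_algebra setT (stopped F tau).
Proof.
split.
- split; first exact: sigma_algebra0.
  by move=> n; rewrite set0I; exact: sigma_set0.
- move=> A [sA At]; split; first exact: sigma_algebraCD.
  move=> n; rewrite setTD (_ : _ `&` _ =
    [set w | le_time (tau w) n] `\` (A `&` [set w | le_time (tau w) n])).
    by apply: sigma_setD => //; exact: tauF.
  by apply/seteqP; split => w /= [? ?]; split => //; [case|move=> ?; tauto].
- move=> A sA; split.
    by apply: sigma_algebra_bigcup => i; case: (sA i).
  by move=> n; rewrite setI_bigcupl; apply: sigma_bigcup => // i; case: (sA i).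
Qed.

Lemma sub_bigcup_filtration n : F n `<=` <<s \bigcup_n F n>>.
Proof. by move=> A FA; apply: sub_sigma_algebra; exists n. Qed.

(* On [tau = None] a decision must be constant, since no finite history reveals
   that event. *)
Lemma stopped_decision (f : T -> bool) :
  (forall w, tau w = None -> f w) ->
  (forall n, F n ([set w | f w = false] `&` [set w | tau w = Some n])) ->
  measurable_wrt (stopped F tau) f.
Proof.
move=> fN fn _ [B _ <-]; rewrite setTI.
have fn' n : F n ([set w | f w = false] `&` [set w | le_time (tau w) n]).
  rewrite (_ : _ `&` _ = [set w | exists i : 'I_n.+1,
      ([set w | f w = false] `&` [set w | tau w = Some (i : nat)]) w]).
    apply: sigma_countable_union => // i; apply: (@filtration_le i n).
      by rewrite -ltnS.
    exact: fn.
  apply/seteqP; split => w /=.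
    case E: (tau w) => [k|] [fw]//= kn.
    by exists (Ordinal (kn : (k < n.+1)%N)).
  case=> i [fw ->]; split => //=; by rewrite -ltnS.
have ff : stopped F tau [set w | f w = false].
  split => //.
  rewrite (_ : mkset _ = \bigcup_n ([set w | f w = false] `&` [set w | le_time (tau w) n])).
    by apply: sigma_algebra_bigcup => n; apply: (@sub_bigcup_filtration n).
  apply/seteqP; split => w /=; last by case=> n _ [].
  move=> fw; case E: (tau w) => [k|]; last by have := fN _ E; rewrite fw.
  by exists k => //; split => //; rewrite /mkset E /=.
have ft : stopped F tau [set w | f w = true].
  rewrite (_ : mkset _ = ~` [set w | f w = false]).
    exact: (sigma_setC stopped_sigma_algebra).
  by apply/seteqP; split => w /=; case: (f w).
rewrite (_ : f @^-1` B = [set w | exists b : bool,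
   ([set _ | B b] `&` [set w | f w = b]) w]).
  apply: (sigma_countable_union stopped_sigma_algebra) => b.
  apply: (sigma_setI stopped_sigma_algebra).
    exact: (sigma_cst stopped_sigma_algebra).
  by case: b.
apply/seteqP; split => w /=; first by move=> Bw; exists (f w).
by case=> b [Bb /= ->].
Qed.

End stopping_times.

Section sigma_of_lemmas.
Context {T : Type} d (S : measurableType d) (f : T -> S).

Lemma sigma_of_preimage B : measurable B -> sigma_of f (f @^-1` B).
Proof. by move=> mB; exists B => //; rewrite setTI. Qed.

Lemma sigma_of_sub (G : set_system T) :
  (forall B, measurable B -> G (f @^-1` B)) -> sigma_of f `<=` G.
Proof. by move=> GB _ [B mB <-]; rewrite setTI; exact: GB. Qed.

End sigma_of_lemmas.

Section hist1_lemmas.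
Context (T : Type) (R : realType) dU (E : measurableType dU) (U : T -> E)
  (Z : nat -> T -> R).
Notation H := (hist1 U Z).

Lemma hist1_sigma n : sigma_algebra setT (H n).
Proof. exact: smallest_sigma_algebra. Qed.

Lemma hist1U n B : measurable B -> H n (U @^-1` B).
Proof.
by move=> mB; apply: sub_sigma_algebra; left; exact: sigma_of_preimage.
Qed.

Lemma hist1Z n i B : (i < n)%N -> measurable B -> H n (Z i @^-1` B).
Proof.
move=> lin mB; apply: sub_sigma_algebra; right; exists i => //.
exact: sigma_of_preimage.
Qed.

Lemma hist1_sub n (G : set_system T) : sigma_algebra setT G ->
  (forall B, measurable B -> G (U @^-1` B)) ->
  (forall i B, (i < n)%N -> measurable B -> G (Z i @^-1` B)) ->
  H n `<=` G.
Proof.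
move=> sG GU GZ; apply: smallest_sub => // A [|[i /= lin]].
  exact: sigma_of_sub.
by apply: sigma_of_sub => B; exact: GZ.
Qed.

Lemma hist1_le n : H n `<=` H n.+1.
Proof.
apply: hist1_sub; [exact: hist1_sigma|exact: hist1U|] => i B lin mB.
by apply: hist1Z => //; rewrite ltnS ltnW.
Qed.

End hist1_lemmas.

Section histm_lemmas.
Context (T : Type) (R : realType) m dU (E : measurableType dU) (U : T -> E)
  (A : nat -> T -> 'I_m) (Y : nat -> T -> R).
Notation H := (histm U A Y).

Lemma histm_sigma n : sigma_algebra setT (H n).
Proof. exact: smallest_sigma_algebra. Qed.

Lemma histmU n B : measurable B -> H n (U @^-1` B).
Proof.
by move=> mB; apply: sub_sigma_algebra; left; exact: sigma_of_preimage.
Qed.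

Lemma histmA n i K : (i < n)%N -> H n (A i @^-1` K).
Proof.
move=> lin; apply: sub_sigma_algebra; right; exists i => //; left.
by exists K => //; rewrite setTI.
Qed.

Lemma histmY n i B : (i < n)%N -> measurable B -> H n (Y i @^-1` B).
Proof.
move=> lin mB; apply: sub_sigma_algebra; right; exists i => //; right.
exact: sigma_of_preimage.
Qed.

Lemma histm_sub n (G : set_system T) : sigma_algebra setT G ->
  (forall B, measurable B -> G (U @^-1` B)) ->
  (forall i k, (i < n)%N -> G [set w | A i w = k]) ->
  (forall i B, (i < n)%N -> measurable B -> G (Y i @^-1` B)) ->
  H n `<=` G.
Proof.
move=> sG GU GA GY; apply: smallest_sub => // X [|[i /= lin [[K _ <-]|]]].
- exact: sigma_of_sub.
- rewrite setTI (_ : _ @^-1` _ = [set w | exists k : 'I_m,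
    ([set _ | K k] `&` [set w | A i w = k]) w]).
    apply: sigma_countable_union => // k; apply: sigma_setI => //.
      exact: sigma_cst.
    exact: GA.
  apply/seteqP; split => w /=; first by move=> Kw; exists (A i w).
  by case=> k [Kk /= ->].
- by apply: sigma_of_sub => B; exact: GY.
Qed.

Lemma histm_le n : H n `<=` H n.+1.
Proof.
apply: histm_sub; [exact: histm_sigma|exact: histmU| |].
- by move=> i k lin; apply: (@histmA _ _ [set k]); rewrite ltnS ltnW.
- by move=> i B lin mB; apply: histmY => //; rewrite ltnS ltnW.
Qed.


End histm_lemmas.

(** * Gaussian and conditional laws *)

Lemma preimage_measurable d (T : measurableType d) d' (S : measurableType d')
    (f : T -> S) B :
  measurable_fun setT f -> measurable B -> measurable (f @^-1` B).
Proof. by move=> mf mB; rewrite -[X in measurable X]setTI; exact: mf. Qed.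

Lemma measurable_fun_bool_prod d (T : measurableType d) d' (S : measurableType d')
    (f : bool * T -> S) :
  (forall b, measurable_fun setT (fun w => f (b, w))) -> measurable_fun setT f.
Proof.
move=> mf _ B mB; rewrite setTI.
apply: (sigma_split (measurable_sigma_algebra (bool * T)%type) (f := fst)) => b.
rewrite (_ : _ `&` _ = [set b] `*` ((fun w => f (b, w)) @^-1` B)).
  by apply: measurableX => //; exact: preimage_measurable.
by apply/seteqP; split => -[b' w] /=; [case=> ? <-|case=> ->].
Qed.

Lemma measurable_enat (R : realType) d' (S : measurableType d') (nu : S -> option nat) :
  (forall n, measurable [set w | nu w = Some n]) ->
  measurable_fun setT (fun w => enat R (nu w)).
Proof.
move=> mnu _ B mB; rewrite setTI.
apply: (sigma_split (measurable_sigma_algebra S) (f := nu)) => -[n|].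
  rewrite (_ : _ `&` _ = [set w | nu w = Some n] `&` [set _ | B (enat R (Some n))]).
    by apply: measurableI => //; exact: (sigma_cst (measurable_sigma_algebra S)).
  by apply/seteqP; split => w /= [] => [Bw nw|nw Bw]; split; move: Bw; rewrite ?nw.
rewrite (_ : _ `&` _ = ~` [set w | exists n, nu w = Some n] `&`
  [set _ | B (enat R None)]).
  apply: measurableI; last exact: (sigma_cst (measurable_sigma_algebra S)).
  apply: measurableC.
  exact: (sigma_countable_union (measurable_sigma_algebra S)).
apply/seteqP; split => w /= [].
  by move=> Bw nw; split; [case=> n; rewrite nw|move: Bw; rewrite nw].
move=> Nw Bw; have nw : nu w = None by case: (nu w) Nw => // n []; exists n.
by rewrite nw.
Qed.

Lemma enat_ge0 (R : realType) (n : option nat) : (0 <= enat R n)%E.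
Proof. by case: n => [n|] //=; rewrite ?lee_fin ?leey. Qed.

Lemma mean_time_ge0 (R : realType) d (T : measurableType d) (P : probability T R)
  (tau : T -> option nat) : (0 <= mean_time P tau)%E.
Proof. by apply: integral_ge0 => w _; exact: enat_ge0. Qed.

Lemma measurable_add (R : realType) (c : R) :
  measurable_fun setT (fun x : R => x + c).
Proof. exact: measurable_funD. Qed.

Lemma preimage_add_measurable (R : realType) (c : R) (B : set R) :
  measurable B -> measurable ((fun x => x + c) @^-1` B).
Proof. by move=> mB; rewrite -[X in measurable X]setTI; exact: measurable_add. Qed.

(** The translated measure gives half-open intervals their length, and this determines Lebesgue
    measure. *)
Lemma lebesgue_measure_shift (R : realType) (c : R) (A : set R) :
  measurable A -> lebesgue_measure ((fun x => x + c) @^-1` A) = lebesgue_measure A.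
Proof.
have mf : measurable_fun [set: measurableTypeR R]
    ((fun x : R => x + c) : measurableTypeR R -> measurableTypeR R).
  exact: measurable_add.
pose nu : {measure set (measurableTypeR R) -> \bar R} :=
  measure_function_pushforward__canonical__measure_function_Measure lebesgue_measure mf.
move=> mA; rewrite [RHS](@lebesgue_measure_unique R nu)// => _ [[a b] _ <-].
rewrite /nu /= /pushforward (_ : _ @^-1` _ = `]a - c, b - c]%classic).
  rewrite !lebesgue_measure_itv/= !lte_fin ltrD2r.
  by case: ifP => // _; rewrite -!EFinB; congr EFin; rewrite opprB addrA subrK.
by apply/seteqP; split => x /=; rewrite !in_itv/= ltrBlDr lerBrDr.
Qed.

(** Reduces every Gaussian law with unit variance to centred noise, by translating the density and
    the Lebesgue measure together. *)
Lemma normal_prob_shift (R : realType) (c : R) (B : set R) : measurable B ->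
  normal_prob c 1 B = normal_prob 0 1 ((fun x => x + c) @^-1` B).
Proof.
move=> mB; rewrite /normal_prob.
have mf : measurable_fun [set: measurableTypeR R]
    ((fun x : R => x + c) : measurableTypeR R -> measurableTypeR R).
  exact: measurable_add.
pose nu : {measure set (measurableTypeR R) -> \bar R} :=
  measure_function_pushforward__canonical__measure_function_Measure lebesgue_measure mf.
transitivity (\int[nu]_(x in B) (normal_pdf c 1 x)%:E)%E.
  apply: eq_measure_integral => A mA _.
  by rewrite /nu /= /pushforward lebesgue_measure_shift.
rewrite /nu ge0_integral_pushforward//=.
- apply: eq_integral => x _ /=; congr EFin.
  rewrite !normal_pdfE ?oner_eq0// /normal_fun.
  by rewrite subr0 addrK.
- apply/measurable_EFinP; apply: measurable_funTS; exact: measurable_normal_pdf.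
- by move=> x _; rewrite lee_fin normal_pdf_ge0.
Qed.

Section sampling_measurability.
Context d (T : measurableType d) (R : realType) m dU (E : measurableType dU)
  (U : T -> E) (A : nat -> T -> 'I_m) (Y : nat -> T -> R).
Hypothesis mU : measurable_fun setT U.
Hypothesis mY : forall t, measurable_fun setT (Y t).

(** The choices [A i] are not assumed measurable; their measurability comes from the sampling rule,
    which refers to an earlier history. Hence the strong induction on time. *)
Lemma histm_measurable t : (forall t k, histm U A Y t [set w | A t w = k]) ->
  histm U A Y t `<=` measurable.
Proof.
move=> rule; elim/ltn_ind: t => t ih; apply: histm_sub.
- exact: measurable_sigma_algebra.
- by move=> B; exact: preimage_measurable.
- by move=> i k it; apply: (ih i) => //; exact: rule.
- by move=> i B _; exact: preimage_measurable.
Qed.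

Lemma hist1_measurable t : hist1 U Y t `<=` measurable.
Proof.
apply: hist1_sub; first exact: measurable_sigma_algebra.
- by move=> B; exact: preimage_measurable.
- by move=> i B _; exact: preimage_measurable.
Qed.

End sampling_measurability.

Section conditional_law.
Local Open Scope ereal_scope.
Context d (T : measurableType d) (R : realType) (P : probability T R) (m : nat)
  (A : T -> 'I_m) (Y : T -> R) (law : 'I_m -> set R -> \bar R) (G : set_system T).
Hypothesis mY : measurable_fun setT Y.
Hypothesis law_ge0 : forall k B, 0 <= law k B.
Hypothesis sG : sigma_algebra setT G.
Hypothesis mG : G `<=` measurable.
Hypothesis GA : forall k, G [set w | A w = k].

Lemma ge0_integral_split (F : set T) (g : 'I_m -> \bar R) :
  G F -> (forall k, 0 <= g k) ->
  \int[P]_(w in F) g (A w) = \sum_(k < m) g k * P (F `&` [set w | A w = k]).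
Proof.
move=> GF g0.
have mFA k : measurable (F `&` [set w | A w = k]).
  by apply: measurableI; apply: mG.
have FE : F = \big[setU/set0]_(k <- enum 'I_m) (F `&` [set w | A w = k]).
  apply/seteqP; split => w.
    move=> Fw; rewrite -bigcup_seq; exists (A w) => //=; exact: mem_enum.
  by rewrite -bigcup_seq => -[k _ []].
rewrite {1}FE ge0_integral_bigsetU//=.
- rewrite big_enum /=; apply: eq_bigr => k _.
  rewrite -integral_cst//; apply: eq_integral => w; rewrite inE => -[_ /= ->].
  by [].
- exact: enum_uniq.
- apply/trivIsetP => i j _ _ ij; apply/seteqP; split => // w [[_ /= Ai] [_ /= Aj]].
  by move: ij; rewrite -Ai -Aj eqxx.
- rewrite -FE.
  have -> : (fun w => g (A w)) = (fun w => \sum_(k < m) g k * (\1_[set w | A w = k] w)%:E).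
    apply/funext => w; rewrite (bigD1 (A w))//= big1 ?adde0.
      by rewrite indicE mem_set//= mule1.
    by move=> k kA; rewrite indicE memNset ?mule0//= => E; rewrite E eqxx in kA.
  apply: emeasurable_sum => k; apply: emeasurable_funM => //.
  by apply/measurable_EFinP; apply: measurable_indic; exact: mG.
Qed.

(** The integrand depends on the sample point only through the arm, so the conditional law may be
    stated arm by arm; that form avoids integrals in all later computations. *)
Lemma integral_law_of_arm :
  (forall F B k, G F -> measurable B ->
     P (F `&` [set w | A w = k] `&` Y @^-1` B) =
     law k B * P (F `&` [set w | A w = k])) ->
  forall F B, G F -> measurable B ->
    P (F `&` Y @^-1` B) = \int[P]_(w in F) law (A w) B.
Proof.
move=> armP F B GF mB; rewrite (@ge0_integral_split F (fun k => law k B))//.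
rewrite (_ : F `&` _ = \big[setU/set0]_(k < m) (F `&` [set w | A w = k] `&` Y @^-1` B)).
  rewrite measure_bigsetU_ord //=.
  - by apply: eq_bigr => k _; exact: armP.
  - move=> k; apply: measurableI; last exact: preimage_measurable.
    by apply: measurableI; apply: mG.
  - apply/trivIsetP => i j _ _ ij; apply/seteqP; split => // w.
    by move=> [[[_ /= Ai] _] [[_ /= Aj] _]]; move: ij; rewrite -Ai -Aj eqxx.
apply/seteqP; split => w.
  move=> [Fw Yw]; rewrite -bigcup_seq; exists (A w) => //=.
  exact: mem_index_enum.
by rewrite -bigcup_seq => -[k _ [[]]].
Qed.

(** The choice of arm belongs to [G], so [F] cut down to one arm is again an admissible conditioning
    event, on which the integrand is constant. *)
Lemma arm_of_integral_law :
  (forall F B, G F -> measurable B ->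
    P (F `&` Y @^-1` B) = \int[P]_(w in F) law (A w) B) ->
  forall F B k, G F -> measurable B ->
     P (F `&` [set w | A w = k] `&` Y @^-1` B) =
     law k B * P (F `&` [set w | A w = k]).
Proof.
move=> intP F B k GF mB.
have GFA : G (F `&` [set w | A w = k]) by apply: sigma_setI.
rewrite intP// -integral_cst//; last exact: mG.
by apply: eq_integral => w; rewrite inE => -[_ /= ->].
Qed.

End conditional_law.

(** * Independence *)

Section pi_systems.
Local Open Scope ereal_scope.
Context d (T : measurableType d) (R : realType).
Context (D : set_system T).
Hypothesis DI : setI_closed D.
Hypothesis DT : D setT.
Hypothesis Dm : D `<=` measurable.

Lemma measure_eq_pi_system (m1 m2 : {measure set T -> \bar R}) :
  m1 setT < +oo -> (forall X, D X -> m1 X = m2 X) ->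
  forall X, <<s D>> X -> m1 X = m2 X.
Proof.
move=> m1T m12; apply: (@g_sigma_algebra_measure_unique _ R T D Dm (fun=> setT)) => //.
by rewrite bigcup_const//; exists 0%N.
Qed.

(** Both sides are finite measures in [X]: the trace of [P] on [C], and [P] scaled by [P C]. *)
Lemma independent_pi_system (P : probability T R) (C : set T) :
  measurable C -> (forall X, D X -> P (X `&` C) = P X * P C) ->
  forall X, <<s D>> X -> P (X `&` C) = P X * P C.
Proof.
move=> mC DC X DX.
have PC : (0 <= fine (P C))%R by apply: fine_ge0.
have scaleE Y : mscale (NngNum PC) P Y = P Y * P C.
  by rewrite /mscale /= fineK ?fin_num_measure// muleC.
rewrite -scaleE.
apply: (@measure_eq_pi_system (mrestr P mC) (mscale (NngNum PC) P)) => //.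
  by rewrite /mrestr /= ltey_eq fin_num_measure//; exact: measurableI.
by move=> Y DY; rewrite [RHS]scaleE; exact: DC.
Qed.

End pi_systems.

Section independent_families.
Local Open Scope ereal_scope.
Context d (T : measurableType d) (R : realType) (P : probability T R).

Lemma mutually_independent_seq (I : choiceType) (G : I -> set_system T) (s : seq I)
    (B : I -> set T) : uniq s -> mutually_independent P G ->
  (forall i, i \in s -> G i (B i)) ->
  P (\bigcap_(i in [set` s]) B i) = \prod_(i <- s) P (B i).
Proof.
move=> us indP GB.
pose J := seq_fset tt s.
have Js : J =i s by move=> i; rewrite seq_fsetE.
rewrite (_ : [set` s] = [set i | i \in J]); last first.
  by apply/seteqP; split => i /=; rewrite Js.
rewrite (indP J B); last by move=> i; rewrite Js; exact: GB.
apply: perm_big; apply: uniq_perm => //; exact: fset_uniq.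
Qed.

Context dU (E : measurableType dU) (U : T -> E) (Z : nat -> T -> R).
Hypothesis mU : measurable_fun setT U.
Hypothesis mZ : forall n, measurable_fun setT (Z n).

(** Finite-dimensional events; they are the pi-system that generates the history after [n]
    observations. *)
Definition cylinder (n : nat) (B : set E) (C : nat -> set R) : set T :=
  U @^-1` B `&` [set w | forall i, (i < n)%N -> C i (Z i w)].

Lemma cylinderS n B C :
  cylinder n.+1 B C = cylinder n B C `&` Z n @^-1` C n.
Proof.
rewrite /cylinder; apply/seteqP; split => w /=.
  move=> [Bw Cw]; split; last exact: Cw.
  by split => // i lin; apply: Cw; rewrite ltnS ltnW.
move=> [[Bw Cw] Cn]; split => // i; rewrite ltnS leq_eqVlt => /predU1P[->//|].
exact: Cw.
Qed.

Lemma measurable_cylinder n B C : measurable B -> (forall i, measurable (C i)) ->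
  measurable (cylinder n B C).
Proof.
move=> mB mC; elim: n => [|n ih].
  rewrite (_ : cylinder 0 B C = U @^-1` B); first exact: preimage_measurable.
  by apply/seteqP; split => w //= [].
by rewrite cylinderS; apply: measurableI => //; exact: preimage_measurable.
Qed.

Lemma hist1_cylinder n :
  hist1 U Z n `<=`
  <<s [set X | exists B C, [/\ measurable B, forall i, measurable (C i) &
                               X = cylinder n B C] ] >>.
Proof.
apply: hist1_sub; first exact: smallest_sigma_algebra.
- move=> B mB; apply: sub_sigma_algebra; exists B, (fun=> setT); split => //.
  by apply/seteqP; split => w //= [].
- move=> i B lin mB; apply: sub_sigma_algebra.
  exists setT, (fun j => if j == i then B else setT); split => //.
    by move=> j; case: ifP.
  apply/seteqP; split => w /=.
    by move=> Bw; split => // j _; case: eqP => // ->.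
  by move=> [_] /(_ _ lin); rewrite eqxx.
Qed.

Lemma setI_closed_cylinder n :
  setI_closed [set X | exists B C, [/\ measurable B, forall i, measurable (C i) &
                               X = cylinder n B C] ].
Proof.
move=> _ _ [B [C [mB mC ->]]] [B' [C' [mB' mC' ->]]].
exists (B `&` B'), (fun i => C i `&` C' i); split.
- exact: measurableI.
- by move=> i; exact: measurableI.
- apply/seteqP; split => w /=.
    move=> [[Bw Cw] [B'w C'w]]; split => // i lin; split;
      [exact: Cw|exact: C'w].
  move=> [[Bw B'w] Cw]; split; split => // i lin; by have [] := Cw _ lin.
Qed.

Hypothesis indP : mutually_independent P
  (fun k : option nat => if k is Some n then sigma_of (Z n) else sigma_of U).

Lemma cylinder_prob n B C : measurable B -> (forall i, measurable (C i)) ->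
  P (cylinder n B C) = P (U @^-1` B) * \prod_(i < n) P (Z i @^-1` C i).
Proof.
move=> mB mC.
pose s := None :: [seq Some i | i <- iota 0 n].
pose X (k : option nat) := if k is Some i then Z i @^-1` C i else U @^-1` B.
have us : uniq s.
  rewrite /s /= map_inj_uniq ?iota_uniq ?andbT; last by move=> ? ? [].
  by apply/mapP => -[].
rewrite (_ : cylinder n B C = \bigcap_(k in [set` s]) X k); last first.
  apply/seteqP; split => w.
    move=> [Bw Cw] [i|] //=; rewrite inE => /orP[//|/mapP[j]].
    by rewrite mem_iota add0n => /andP[_ jn] [->]; exact: Cw.
  move=> Xw; split; first by apply: (Xw None); rewrite /= inE.
  move=> i lin; apply: (Xw (Some i)); rewrite /= inE; apply/orP; right.
  by apply: map_f; rewrite mem_iota.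
rewrite (mutually_independent_seq us indP); last first.
  by move=> [i|] _; exact: sigma_of_preimage.
rewrite big_cons big_map; congr (_ * _).
by rewrite -[in LHS](subn0 n) -/(index_iota 0 n) big_mkord.
Qed.

(** Converts the mutual independence required of a test into the conditional law required of a
    procedure: the product formula on cylinders extends to the whole history. *)
Lemma independent_next n F B : hist1 U Z n F -> measurable B ->
  P (F `&` Z n @^-1` B) = P F * P (Z n @^-1` B).
Proof.
move=> /hist1_cylinder HF mB; move: F HF; apply: independent_pi_system.
- exact: setI_closed_cylinder.
- exists setT, (fun=> setT); split => //; apply/seteqP; split => w //=.
- by move=> _ [B' [C [mB' mC ->]]]; exact: measurable_cylinder.
- exact: preimage_measurable.
- move=> _ [B' [C [mB' mC ->]]].
  (* Placing [B] at coordinate [n] makes the intersection a cylinder of length [n.+1]. *)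
  pose C' i := if (i < n)%N then C i else B.
  have C'E i : (i < n)%N -> C' i = C i by rewrite /C' => ->.
  have C'n : C' n = B by rewrite /C' ltnn.
  have mC' i : measurable (C' i) by rewrite /C'; case: ifP.
  have <- : cylinder n B' C' = cylinder n B' C.
    apply/seteqP; split => w [? Cw]; split => // i lin;
      have := Cw _ lin; by rewrite C'E.
  by rewrite -{1}C'n -cylinderS !cylinder_prob// big_ord_recr /= muleA C'n.
Qed.

End independent_families.

(** * Lists of noise variables sorted by a predictable colour *)

Section occurrences.
Implicit Types (a : nat -> bool) (b : bool).

Definition occ a b t : nat := (\sum_(i < t) (a i == b))%N.

Lemma occ0 a b : occ a b 0 = 0%N.
Proof. by rewrite /occ big_ord0. Qed.

Lemma occS a b t : occ a b t.+1 = (occ a b t + (a t == b))%N.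
Proof. by rewrite /occ big_ord_recr. Qed.

Lemma occ_le a b s t : (s <= t)%N -> (occ a b s <= occ a b t)%N.
Proof.
move=> /subnKC <-; elim: (t - s)%N => [|k ih]; first by rewrite addn0.
by rewrite addnS occS; lia.
Qed.

Lemma occC a t : (occ a true t + occ a false t)%N = t.
Proof.
elim: t => [|t ih]; first by rewrite !occ0.
by rewrite !occS; case: (a t) => /=; lia.
Qed.

Lemma occ_bound a b t : (occ a b t <= t)%N.
Proof. by have := occC a t; case: b; lia. Qed.

(** The round at which colour [b] occurs after exactly [n] earlier occurrences; the value is [0]
    when there is no such round. *)
Definition slot a b n : nat := xget 0%N [set t | a t = b /\ occ a b t = n].

(** The count increases strictly across each occurrence of [b], so two occurrences never share the
    same index. *)
Lemma slot_eq a b t : a t = b -> slot a b (occ a b t) = t.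
Proof.
move=> atb; apply: xget_unique => //= s [asb Ost].
apply/eqP; rewrite eqn_leq; apply/andP; split; rewrite leqNgt; apply/negP => lt_st.
  by have := occ_le a b lt_st; rewrite occS atb eqxx; lia.
by have := occ_le a b lt_st; rewrite occS asb eqxx; lia.
Qed.

Lemma slotP a b n t : (n < occ a b t)%N ->
  [/\ (slot a b n < t)%N, a (slot a b n) = b & occ a b (slot a b n) = n].
Proof.
elim: t => [|t ih]; first by rewrite occ0.
rewrite occS; case: (ltnP n (occ a b t)) => [/ih [? ? ?]|le_n] lt_n.
  by split => //; apply: ltnW.
have atb : a t = b by apply/eqP; move: lt_n; case: (a t == b) => //; lia.
have -> : n = occ a b t by move: lt_n; rewrite atb eqxx; lia.
by rewrite slot_eq.
Qed.

End occurrences.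

Section stacks.
Context d (T : measurableType d) (R : realType) (P : probability T R).
Context (F : nat -> set_system T) (xi : nat -> T -> R) (c : nat -> T -> bool).
Context (v : set R -> R).
Hypothesis sF : forall t, sigma_algebra setT (F t).
Hypothesis ndF : forall t, F t `<=` F t.+1.
Hypothesis mF : forall t, F t `<=` measurable.
Hypothesis cF : forall t, F t [set w | c t w = true].
Hypothesis xiF : forall t B, measurable B -> F t.+1 (xi t @^-1` B).
Hypothesis xi_law : forall t H B, F t H -> measurable B ->
  (P (H `&` xi t @^-1` B) = P H * (v B)%:E)%E.
Hypothesis recurrent : forall b n,
  {ae P, forall w, exists t, (n <= occ (c ^~ w) b t)%N}.

Definition stack (b : bool) (n : nat) (w : T) : R := xi (slot (c ^~ w) b n) w.

Let pr A := fine (P A).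

Let prE A : measurable A -> P A = (pr A)%:E.
Proof. by move=> mA; rewrite /pr fineK// fin_num_measure. Qed.

Let pr_ge0 A : 0 <= pr A.
Proof. exact: fine_ge0. Qed.

Let le_pr A B : measurable A -> measurable B -> A `<=` B -> pr A <= pr B.
Proof.
by move=> mA mB AB; rewrite -lee_fin -!prE//; apply: le_measure; rewrite ?inE.
Qed.

Let prU A B : measurable A -> measurable B -> A `&` B = set0 ->
  pr (A `|` B) = pr A + pr B.
Proof.
move=> mA mB AB; apply: EFin_inj; rewrite EFinD -!prE ?measureU//.
exact: measurableU.
Qed.

Lemma color_filtration b t : F t [set w | c t w = b].
Proof.
case: b; first exact: cF.
rewrite (_ : mkset _ = ~` [set w | c t w = true]); first exact: sigma_setC.
by apply/seteqP; split => w /=; case: (c t w).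
Qed.

Lemma occ_filtration b n t : F t [set w | occ (c ^~ w) b t = n].
Proof.
elim: t n => [|t ih] n.
  rewrite (_ : mkset _ = [set _ | 0%N = n]); first exact: sigma_cst.
  by apply/seteqP; split => w /=; rewrite occ0.
rewrite (_ : mkset _ = ([set w | c t w = ~~ b] `&` [set w | occ (c ^~ w) b t = n])
  `|` ([set w | c t w = b] `&`
       ([set _ | (0 < n)%N] `&` [set w | occ (c ^~ w) b t = n.-1]))).
  have ? b' : F t.+1 [set w | c t w = b'] by apply/ndF/color_filtration.
  apply: sigma_setU => //; apply: sigma_setI => //; first exact: ndF.
  by apply: sigma_setI => //; [exact: sigma_cst|exact: ndF].
apply/seteqP; split => w /=; rewrite occS {ih}.
  by case: (c t w) b => -[] /=; rewrite ?addn0 => E; [right|left|left|right];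
    split => //; lia.
by case=> -[->]; [case: b => /=; lia|rewrite eqxx; lia].
Qed.

Lemma slot_measurable b n t : measurable [set w | slot (c ^~ w) b n = t].
Proof.
have mv s : measurable [set w | c s w = b /\ occ (c ^~ w) b s = n].
  by apply: measurableI; apply: (@mF s);
    [exact: color_filtration|exact: occ_filtration].
rewrite (_ : mkset _ = [set w | c t w = b /\ occ (c ^~ w) b t = n] `|`
   ([set _ | 0%N = t] `&`
   [set w | forall s, (~` [set w | c s w = b /\ occ (c ^~ w) b s = n]) w])).
  apply: measurableU => //; apply: measurableI.
    exact: (sigma_cst (measurable_sigma_algebra T)).
  apply: (sigma_countable_inter (measurable_sigma_algebra T)) => s.
  exact: measurableC.
apply/seteqP; split => w /=.
  rewrite /slot; case: xgetP => [s -> /= [? ?] <-|Nv <-]; first by left.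
  by right; split => // s; exact: Nv.
case=> [[<- <-]|[<- Nv]]; first exact: slot_eq.
by rewrite /slot; apply: xgetPN => s; exact: Nv.
Qed.

Lemma measurable_stack b n : measurable_fun setT (stack b n).
Proof.
move=> _ B mB; rewrite setTI.
apply: (sigma_split (measurable_sigma_algebra T)
  (f := fun w => slot (c ^~ w) b n)) => t.
rewrite (_ : _ `&` _ = xi t @^-1` B `&` [set w | slot (c ^~ w) b n = t]).
  apply: measurableI; last exact: slot_measurable.
  by apply: mF; exact: xiF.
by apply/seteqP; split => w /= [+ st]; rewrite /stack st.
Qed.

Let v_ge0 B : measurable B -> 0 <= v B.
Proof.
move=> mB; have := xi_law (sigma_setT (sF 0)) mB.
by rewrite setTI probability_setT mul1e -lee_fin => <-.
Qed.

Let v_le1 B : measurable B -> v B <= 1.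
Proof.
move=> mB; have := xi_law (sigma_setT (sF 0)) mB.
rewrite setTI probability_setT mul1e -lee_fin => <-; apply: probability_le1.
by apply: mF; exact: xiF.
Qed.

Let vT : v setT = 1.
Proof.
have := xi_law (sigma_setT (sF 0)) measurableT.
by rewrite setTI preimage_setT probability_setT mul1e => -[].
Qed.

Let pr_law t H B : F t H -> measurable B -> pr (H `&` xi t @^-1` B) = pr H * v B.
Proof.
move=> FH mB; rewrite /pr xi_law// fineM//.
by apply: fin_num_measure; apply: mF FH.
Qed.

Lemma measurable_stack_constraints (C : bool -> nat -> set R) N :
  (forall b i, measurable (C b i)) ->
  measurable [set w | forall b i, (i < N)%N -> C b i (stack b i w)].
Proof.
move=> mC.
rewrite (_ : mkset _ = [set w | forall b, [set w | forall i,
  (if (i < N)%N then stack b i @^-1` C b i else setT) w] w]).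
  apply: (sigma_countable_inter (measurable_sigma_algebra T)) => b.
  apply: (sigma_countable_inter (measurable_sigma_algebra T)) => i.
  case: ifP => // _; apply: preimage_measurable => //; exact: measurable_stack.
apply/seteqP; split => w /= gw b i; first by case: ifP => // iN; exact: gw.
by move=> iN; have := gw b i; rewrite iN.
Qed.

(** * The product formula for finitely many constraints on the two lists *)

Section target.
Context (C : bool -> nat -> set R) (N : nat) (H : set T).
Hypothesis mC : forall b i, measurable (C b i).
Hypothesis CT : forall b i, (N <= i)%N -> C b i = setT.
Hypothesis FH : F 0 H.

Let u b i := v (C b i).
(* Weight of the constraints on colour [b] that are still open after [a]
   observations of that colour. *)
Let wt b a : R := \prod_(a <= i < N) u b i.

Let wt_step b a : wt b a = u b a * wt b a.+1.
Proof.
rewrite /wt; case: (ltnP a N) => aN; first by rewrite big_ltn.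
by rewrite !big_geq ?leqW// mulr1 /u CT// vT.
Qed.

Let wt_ge0 b a : 0 <= wt b a.
Proof. by apply: prodr_ge0 => i _; exact: v_ge0. Qed.

Let wt_le1 b a : wt b a <= 1.
Proof.
by rewrite /wt; apply: prodr_ile1 => i _; rewrite v_ge0//= v_le1.
Qed.

Let wt1 b a : (N <= a)%N -> wt b a = 1.
Proof. by move=> Na; rewrite /wt big_geq. Qed.

Let good t : set T := H `&` [set w | forall i, (i < t)%N ->
  C (c i w) (occ (c ^~ w) (c i w) i) (xi i w)].

Let goodS t : good t.+1 = good t `&`
   [set w | C (c t w) (occ (c ^~ w) (c t w) t) (xi t w)].
Proof.
apply/seteqP; split => w /=.
  move=> [Hw gw]; split; last exact: gw.
  by split => // i it; apply: gw; rewrite ltnS ltnW.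
move=> [[Hw gw] gt]; split => // i; rewrite ltnS leq_eqVlt => /predU1P[->//|].
exact: gw.
Qed.

(** Fixing the number [a] of [true] rounds also fixes the number [t - a] of [false] rounds, so the
    weight of the open constraints is constant on each piece. *)
Let E t a : set T := good t `&` [set w | occ (c ^~ w) true t = a].

Let E_step t a b : E t a `&` [set w | c t w = b] `&`
    [set w | C (c t w) (occ (c ^~ w) (c t w) t) (xi t w)] =
  E t a `&` [set w | c t w = b] `&`
    xi t @^-1` C b (if b then a else (t - a)%N).
Proof.
have idx w : occ (c ^~ w) true t = a -> c t w = b ->
    occ (c ^~ w) (c t w) t = (if b then a else t - a)%N.
  by move=> oa ->; have := occC (c ^~ w) t; case: b; rewrite oa //; lia.
by apply/seteqP; split => w [[[gw /= ow] cw]] /= Cw; split => //; move: Cw;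
  rewrite idx// cw.
Qed.

Let E_succ t a : E t.+1 a.+1 =
  (E t a `&` [set w | c t w = true] `&` xi t @^-1` C true a) `|`
  (E t a.+1 `&` [set w | c t w = false] `&` xi t @^-1` C false (t - a.+1)).
Proof.
rewrite -(E_step t a true) -(E_step t a.+1 false) /E goodS.
apply/seteqP; split => w /=.
  move=> [[gw Cw]]; rewrite occS; case ct: (c t w) => /=.
    by rewrite addn1 => -[oa]; left; rewrite ct in Cw.
  by rewrite addn0 => oa; right; rewrite ct in Cw.
by rewrite occS => -[] [[[gw oa] ct] Cw] /=; rewrite ct in Cw *; split => //=;
  rewrite oa ?addn1 ?addn0.
Qed.

Let E_zero t : E t.+1 0 =
  E t 0 `&` [set w | c t w = false] `&` xi t @^-1` C false t.
Proof.
have := E_step t 0 false; rewrite /= subn0 => <-; rewrite /E goodS.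
apply/seteqP; split => w /=.
  move=> [[gw Cw]]; rewrite occS; case ct: (c t w) => /=; first by rewrite addn1.
  by rewrite addn0 => oa; rewrite ct in Cw.
by rewrite occS => -[[[gw oa] ct] Cw] /=; rewrite ct in Cw *; split => //=;
  rewrite oa ?addn1 ?addn0.
Qed.

Let FE t a : F t (E t a).
Proof.
elim: t a => [|t ih] a.
  rewrite (_ : E 0 a = H `&` [set w | occ (c ^~ w) true 0 = a]).
    by apply: sigma_setI => //; exact: occ_filtration.
  by apply/seteqP; split => w /=; [case=> -[]|case].
have FE' b a' n : F t.+1 (E t a' `&` [set w | c t w = b] `&` xi t @^-1` C b n).
  apply: sigma_setI => //; last exact: xiF.
  by apply: ndF; apply: sigma_setI => //; exact: color_filtration.
case: a => [|a]; first by rewrite E_zero.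
by rewrite E_succ; apply: sigma_setU.
Qed.

Let mE t a : measurable (E t a).
Proof. exact: mF. Qed.

Let g b t a := pr (E t a `&` [set w | c t w = b]).

Let pr_step b t a n :
  pr (E t a `&` [set w | c t w = b] `&` xi t @^-1` C b n) = g b t a * u b n.
Proof.
by rewrite pr_law//; apply: sigma_setI => //; exact: color_filtration.
Qed.

Let mcolor b t : measurable [set w | c t w = b].
Proof. by apply: (@mF t); exact: color_filtration. Qed.

Let mxi t b n : measurable (xi t @^-1` C b n).
Proof. by apply: (@mF t.+1); exact: xiF. Qed.

Let g_split t a : pr (E t a) = g true t a + g false t a.
Proof.
rewrite /g -prU; [|by apply: measurableI|by apply: measurableI|].
  congr pr; apply/seteqP; split => w; last by case=> -[].
  by move=> Ew; case ct: (c t w); [left|right].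
by apply/seteqP; split => // w [[_ /= ->] []].
Qed.

Let g_out t : g false t t.+1 = 0.
Proof.
rewrite /g (_ : _ `&` _ = set0); first by rewrite /pr measure0.
apply/seteqP; split => // w [[_ /= ow] _].
by have := occ_bound (c ^~ w) true t; rewrite ow ltnn.
Qed.

(* The expectation of a martingale: the indicator that all constraints met so far
   hold, times the weight of the open ones. *)
Let Q t := \sum_(a < t.+1) pr (E t a) * (wt true a * wt false (t - a)).

(** Given the past, a round of colour [b] meets its constraint with probability [u], which is
    exactly the factor between the weight before the round and the weight after it. *)
Let Q_step t : Q t.+1 = Q t.
Proof.
rewrite /Q big_ord_recl /= E_zero pr_step subn0.
(* A [true] round raises the count by one and a [false] round keeps it; in the [true] terms the
   factor [u] is absorbed at once by [wt_step]. *)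
have -> : \sum_(i < t.+1) pr (E t.+1 (bump 0 i)) *
    (wt true (bump 0 i) * wt false (t.+1 - bump 0 i)) =
  \sum_(i < t.+1) g true t i * (wt true i * wt false (t - i)) +
  \sum_(i < t.+1) g false t i.+1 * u false (t - i.+1) *
      (wt true i.+1 * wt false (t - i)).
  rewrite -big_split /=; apply: eq_bigr => i _.
  rewrite /bump leq0n add1n subSS E_succ prU.
  - rewrite !pr_step (wt_step true i); ring.
  - by apply: measurableI => //; apply: measurableI.
  - by apply: measurableI => //; apply: measurableI.
  - by apply/seteqP; split => // w [[[_ /= ->] _] [[]]].
(* The last term would need [t.+1] rounds of colour [true] among [t]. Without it the [false] sums on
   both sides have the same range. *)
rewrite [X in _ + (_ + X) = _]big_ord_recr /= g_out !mul0r addr0.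
under [in RHS]eq_bigr do rewrite g_split mulrDl.
rewrite big_split /= addrCA; congr (_ + _).
rewrite [in RHS]big_ord_recl /= subn0 (wt_step false t) ; congr (_ + _); first ring.
apply: eq_bigr => i _; rewrite /bump leq0n add1n.
have -> : (t - i = (t - i.+1).+1)%N by have := ltn_ord i; lia.
by rewrite (wt_step false (t - i.+1)); ring.
Qed.

Let QE t : Q t = pr H * (wt true 0 * wt false 0).
Proof.
elim: t => [|t <-]; last exact: Q_step.
rewrite /Q big_ord1 /= subn0; congr (pr _ * _).
by apply/seteqP; split => w /=; [case=> -[]|move=> Hw; split=> //; exact: occ0].
Qed.

Let full t : set T :=
  [set w | (N <= occ (c ^~ w) true t)%N /\ (N <= occ (c ^~ w) false t)%N].

Let target : set T := H `&` [set w | forall b i, (i < N)%N -> C b i (stack b i w)].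

(** Once each colour has occurred [N] times, every nontrivial constraint concerns a round before
    [t], and checking by round or by list entry is the same. *)
Let good_full t : good t `&` full t = target `&` full t.
Proof.
apply/seteqP; split => w [[Hw gw] fw]; split => //; split => //.
  move=> b i iN.
  have [|st cs os] := @slotP (c ^~ w) b i t.
    by apply: leq_trans iN _; case: b; case: fw.
  by have /= := gw _ st; rewrite /stack cs os.
move=> i it /=.
have [lt|ge] := ltnP (occ (c ^~ w) (c i w) i) N; last by rewrite CT.
by have /= := gw (c i w) _ lt; rewrite /stack slot_eq.
Qed.

Let Ffull t : F t (full t).
Proof.
have Focc b : F t [set w | (N <= occ (c ^~ w) b t)%N].
  rewrite (_ : mkset _ = [set w | exists n, ([set _ | (N <= n)%N] `&`
      [set w | occ (c ^~ w) b t = n]) w]).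
    apply: sigma_countable_union => // n; apply: sigma_setI => //.
      exact: sigma_cst.
    exact: occ_filtration.
  by apply/seteqP; split => w /=; [eexists; split; last by []|case=> n [? ->]].
exact: (sigma_setI (sF t) (Focc true) (Focc false)).
Qed.

Let mfull t : measurable (full t).
Proof. exact: mF (Ffull t). Qed.

Let mtarget : measurable target.
Proof.
apply: measurableI; first exact: mF FH.
exact: measurable_stack_constraints.
Qed.

Let sum_occ t A : measurable A ->
  pr A = \sum_(a < t.+1) pr (A `&` [set w | occ (c ^~ w) true t = a]).
Proof.
move=> mA.
have mO a : measurable [set w | occ (c ^~ w) true t = a].
  by apply: (@mF t); exact: occ_filtration.
have AO : A = \big[setU/set0]_(a < t.+1) (A `&` [set w | occ (c ^~ w) true t = a]).
  apply/seteqP; split => w; rewrite -bigcup_seq; last by case=> a _ [].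
  have ot : (occ (c ^~ w) true t < t.+1)%N by rewrite ltnS occ_bound.
  by move=> Aw; exists (Ordinal ot) => //=; exact: mem_index_enum.
apply: EFin_inj; rewrite -prE// {1}AO measure_bigsetU_ord//=.
- rewrite -sumEFin; apply: eq_bigr => a _; apply: prE; exact: measurableI.
- by move=> a; exact: measurableI.
- apply/trivIsetP => i j _ _ ij; apply/seteqP; split => // w [[_ /= oi] [_ /= oj]].
  by move/eqP: ij; apply; apply: val_inj => /=; rewrite -oi -oj.
Qed.

(** On [full t] no constraint is open and the weights are one; a piece whose index rules out
    [full t] contributes nothing to the left-hand side. *)
Let Q_lower t : pr (target `&` full t) <= Q t.
Proof.
rewrite -good_full (@sum_occ t); last first.
  by rewrite good_full; apply: measurableI.
apply: ler_sum => a _.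
have [/andP[Na Nt]|Nf] := boolP ((N <= a)%N && (N <= t - a)%N).
  rewrite !wt1// !mulr1; apply: le_pr => //.
    rewrite good_full; apply: measurableI; first exact: measurableI.
    by apply: (@mF t); exact: occ_filtration.
  by move=> w [[]].
rewrite (_ : _ `&` _ = set0); first by rewrite {1}/pr measure0 !mulr_ge0.
apply/seteqP; split => // w [[_ [/= f1 f2]] oa].
move/negP: Nf; apply; rewrite -oa f1 /=.
by have := occC (c ^~ w) t; move: f2; rewrite /=; lia.
Qed.

(** The weights are at most one, and [good t] can leave [target] only outside [full t]. *)
Let Q_upper t : Q t <= pr (target `&` full t) + pr (~` full t).
Proof.
have mt : measurable (target `&` full t) by exact: measurableI.
have mU : measurable ((target `&` full t) `|` ~` full t).
  by apply: measurableU => //; exact: measurableC.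
rewrite -prU//; [|exact: measurableC|]; last first.
  by apply/seteqP; split => // w [[_ fw] /(_ fw)].
rewrite (@sum_occ t)//; apply: ler_sum => a _.
apply: le_trans (_ : pr (E t a) <= _).
  rewrite -[leRHS]mulr1 ler_wpM2l// -[leRHS]mulr1 ler_pM//.
apply: le_pr => //.
  by apply: measurableI => //; apply: (@mF t); exact: occ_filtration.
rewrite -good_full => w [gw ow]; split => //.
by have [fw|fw] := pselect (full t w); [left|right].
Qed.

(** Both colours recur almost surely, so the complements of [full t] decrease to a null set. *)
Let not_full_cvg : (fun t => pr (~` full t)) @ \oo --> (0 : R).
Proof.
have full0 : P (\bigcap_t ~` full t) = 0%E.
  apply/eqP; rewrite eq_le measure_ge0 andbT.
  have : P.-negligible (\bigcap_t ~` full t).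
    have [A [mA PA subA]] := recurrent true N.
    have [B [mB PB subB]] := recurrent false N.
    apply: (@negligibleS _ _ _ _ (A `|` B)).
      move=> w nfw; apply: contrapT => /not_orP[nA nB].
      have [t1 h1] : exists t, (N <= occ (c ^~ w) true t)%N.
        by apply: contrapT => ?; apply: nA; exact: subA.
      have [t2 h2] : exists t, (N <= occ (c ^~ w) false t)%N.
        by apply: contrapT => ?; apply: nB; exact: subB.
      apply: (nfw (maxn t1 t2)) => //; split.
        by apply: leq_trans h1 _; apply: occ_le; exact: leq_maxl.
      by apply: leq_trans h2 _; apply: occ_le; exact: leq_maxr.
    by apply: negligibleU; [exists A; split|exists B; split].
  move=> /measure_negligible => -> //.
  by apply: bigcap_measurableType => t _; exact: measurableC.
have : (P \o (fun t => ~` full t)) @ \oo --> P (\bigcap_t ~` full t).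
  apply: nonincreasing_cvg_mu.
  - by rewrite ltey_eq fin_num_measure//; exact: measurableC.
  - by move=> t; exact: measurableC.
  - by apply: bigcap_measurableType => t _; exact: measurableC.
  - move=> s t st; apply/subsetPset => w /=; apply: contra_not => -[f1 f2].
    by split; [apply: leq_trans f1 _|apply: leq_trans f2 _]; exact: occ_le.
rewrite full0 => /fine_cvgP[_].
exact.
Qed.

(** [Q] is constant in [t], so its initial value differs from the probability of [target] by at most
    that of the complement of [full t], which tends to zero. *)
Lemma stack_target_prob :
  fine (P target) = fine (P H) * (\prod_(i < N) v (C true i) * \prod_(i < N) v (C false i)).
Proof.
have wt0 b : wt b 0 = \prod_(i < N) v (C b i) by rewrite /wt big_mkord.
rewrite -!wt0 -/(pr _) -/(pr _); set q := _ * _.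
have diff t : `|q - pr target| <= pr (~` full t).
  have mnf : measurable (~` full t) by exact: measurableC.
  have mtf : measurable (target `&` full t) by exact: measurableI.
  have mtn : measurable (target `&` ~` full t) by exact: measurableI.
  have split_t : pr target = pr (target `&` full t) + pr (target `&` ~` full t).
    rewrite -prU//; first by rewrite -setIUr setUv setIT.
    by rewrite setIACA setICr setI0.
  have le_n : pr (target `&` ~` full t) <= pr (~` full t) by apply: le_pr.
  have := Q_lower t; have := Q_upper t; rewrite QE -/q split_t => up low.
  have := pr_ge0 (target `&` ~` full t); rewrite ler_norml; lra.
have : `|q - pr target| <= 0.
  rewrite -(cvg_lim (@Rhausdorff R) not_full_cvg).
  by apply: limr_ge; [exact: cvgP not_full_cvg|exact: nearW].
by rewrite normr_le0 subr_eq0 => /eqP <-.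
Qed.

End target.

(** Finite-dimensional form of the claim that both lists are i.i.d. with law [v], independent of
    each other and of [F 0]. Constraints of index at least [N] are replaced by [setT] to fit the
    preceding computation. *)
Lemma stack_independent (C : bool -> nat -> set R) (N : nat) (H : set T) :
  (forall b i, measurable (C b i)) -> F 0 H ->
  (P (H `&` [set w | forall b i, (i < N)%N -> C b i (stack b i w)]) =
   P H * (\prod_(i < N) v (C true i) * \prod_(i < N) v (C false i))%:E)%E.
Proof.
move=> mC FH; pose C' b i := if (i < N)%N then C b i else setT.
have C'E b i : (i < N)%N -> C' b i = C b i by rewrite /C' => ->.
have mC' b i : measurable (C' b i) by rewrite /C'; case: ifP.
have C'T b i : (N <= i)%N -> C' b i = setT by rewrite /C' leqNgt; case: ifP.
have := stack_target_prob mC' C'T FH.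
rewrite (_ : [set w | forall b i, (i < N)%N -> C' b i (stack b i w)] =
  [set w | forall b i, (i < N)%N -> C b i (stack b i w)]); last first.
  by apply/seteqP; split => w /= Cw b i iN; have := Cw b i iN; rewrite C'E.
under eq_bigr => i _ do rewrite C'E//.
under [X in _ * (_ * X)]eq_bigr => i _ do rewrite C'E//.
move=> fineE; rewrite -[LHS]fineK ?fineE ?EFinM ?fineK//.
  by apply: fin_num_measure; apply: mF FH.
apply: fin_num_measure; apply: measurableI; first exact: mF FH.
exact: measurable_stack_constraints.
Qed.

End stacks.

(* Keeps the conversion test from unfolding Gaussian integrals. *)
#[local] Opaque normal_prob.

(** * Lower bound: the test of one coordinate inside a procedure *)

Section test_of_procedure.
Context d (T : measurableType d) (R : realType) (m : nat) (Delta : R)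
  (P : {ffun 'I_m -> bool} -> probability T R)
  dU (E : measurableType dU) (U : T -> E)
  (A : nat -> T -> 'I_m) (Y : nat -> T -> R) (tau : T -> option nat).
Local Notation H := (histm U A Y).
Hypothesis mU : measurable_fun setT U.
Hypothesis mY : forall t, measurable_fun setT (Y t).
Hypothesis lawU : forall s s' B, measurable B ->
  P s (U @^-1` B) = P s' (U @^-1` B).
Hypothesis rule : forall t k, H t [set w | A t w = k].
Hypothesis lawY : forall s t F B, H t F -> measurable B ->
  P s (F `&` Y t @^-1` B) =
  (\int[P s]_(w in F) normal_prob (sgnb R (s (A t w)) * Delta)%R 1%R B)%E.
Hypothesis tau_stop : stopping_time H tau.
Hypothesis tau_fin : forall s, {ae P s, forall w, tau w <> None}.
Context (dec : T -> bool).
Hypothesis dec_none : forall w, tau w = None -> dec w.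
Hypothesis dec_stop : forall n,
  H n ([set w | dec w = false] `&` [set w | tau w = Some n]).
Context (j : 'I_m) (r : {ffun 'I_m -> bool}).

Definition set_sign (b : bool) : {ffun 'I_m -> bool} :=
  [ffun k => if k == j then b else r k].

(* Before [tau] a round is coloured by whether arm [j] is sampled; afterwards the
   colours alternate, so that both stacks below are infinite almost surely. *)
Definition color (t : nat) (w : T) : bool :=
  if le_time (tau w) t then odd t else A t w == j.

(** Centred at the mean that is correct under [P (set_sign b)]; [b] enters only in rounds that
    sample [j]. *)
Definition noise (b : bool) (t : nat) (w : T) : R :=
  Y t w - sgnb R (set_sign b (A t w)) * Delta.

Let mH t : H t `<=` measurable.
Proof. exact: histm_measurable. Qed.

Let sH t : sigma_algebra setT (H t).
Proof. exact: histm_sigma. Qed.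

Let ndH t : H t `<=` H t.+1.
Proof. exact: histm_le. Qed.

Let colorH t : H t [set w | color t w = true].
Proof.
rewrite (_ : mkset _ = ([set w | le_time (tau w) t] `&` [set _ | odd t]) `|`
   ([set w | ~~ le_time (tau w) t] `&` [set w | A t w = j])).
  apply: (sigma_setU (sH t)); apply: (sigma_setI (sH t)) => //.
    exact: (sigma_cst (sH t)).
  exact: (not_stopped sH tau_stop).
apply/seteqP; split => w /=; rewrite /color; case: ifP => _.
- by left.
- by move=> /eqP; right.
- by case=> -[].
- by case=> -[] // _ ->; rewrite eqxx.
Qed.

Let armY s t := arm_of_integral_law (P := P s)
  (law := fun k => normal_prob (sgnb R (s k) * Delta) 1) (sH t) (@mH t)
  (@rule t) (@lawY s t).

Lemma measurable_noise_arm b t k B : measurable B ->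
  H t.+1 ([set w | A t w = k] `&` noise b t @^-1` B).
Proof.
move=> mB.
rewrite (_ : _ `&` _ = [set w | A t w = k] `&`
   Y t @^-1` ((fun x => x + - (sgnb R (set_sign b k) * Delta)) @^-1` B)).
  apply: (sigma_setI (sH t.+1)) => //; first exact: ndH.
  by apply: histmY => //; exact: preimage_add_measurable.
by apply/seteqP; split => w /= [Ak]; rewrite /noise Ak.
Qed.

Lemma noise_hist b t B : measurable B -> H t.+1 (noise b t @^-1` B).
Proof.
move=> mB; apply: (sigma_split (@sH _) (f := A t)) => k.
by rewrite setIC; exact: measurable_noise_arm.
Qed.

(** After centring, the law is standard normal whichever arm is drawn, so the arm-wise conditional
    laws integrate to a constant. *)
Lemma noise_law b t F B : H t F -> measurable B ->
  (P (set_sign b) (F `&` noise b t @^-1` B) =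
   P (set_sign b) F * (fine (normal_prob 0 1 B))%:E)%E.
Proof.
move=> HF mB; rewrite fineK; last exact: fin_num_measure.
rewrite muleC -(@integral_cst _ _ _ (P (set_sign b)) F (mH HF) (normal_prob 0 1 B)).
apply: (integral_law_of_arm (A := A t) (G := H t)
  (law := fun (k : 'I_m) B => normal_prob (0 : R) 1 B)) => //.
- by move=> _ C mC; rewrite setTI; apply: (@mH t.+1); exact: noise_hist.
- move=> G C k HG mC.
  pose C' := (fun x => x + - (sgnb R (set_sign b k) * Delta)) @^-1` C.
  have mC' : measurable C' by exact: preimage_add_measurable.
  rewrite (_ : _ `&` noise b t @^-1` C = G `&` [set w | A t w = k] `&` Y t @^-1` C').
    rewrite (@armY (set_sign b) t G C' k HG mC'); congr (_ * _)%E.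
    rewrite [LHS]normal_prob_shift//; congr (normal_prob _ _ _).
    by apply/seteqP; split => x; rewrite /C' /preimage /= addrK.
  by apply/seteqP; split => w /= [[Gw Ak]]; rewrite /C' /noise /= Ak.
Qed.

Lemma color_recurrent s b n :
  {ae P s, forall w, exists t, (n <= occ (color ^~ w) b t)%N}.
Proof.
apply: filterS (tau_fin s) => w; case tw : (tau w) => [t0|] // _.
(* Any two consecutive rounds from [t0] on contain each colour once, so [n.*2] of them suffice. *)
exists (t0 + n.*2)%N; elim: n => [|n ih] //.
have alt : ((odd (t0 + n.*2) == b) + (odd (t0 + n.*2).+1 == b))%N = 1%N.
  by rewrite /=; case: (odd _); case: (b).
rewrite doubleS !addnS !occS -addnA.
have -> : ((color (t0 + n.*2) w == b) + (color (t0 + n.*2).+1 w == b) = 1)%N.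
  by rewrite /color tw /= !leqW ?leq_addr.
by rewrite addn1 ltnS.
Qed.

Definition stack_of b := stack (noise b) color.

Let independence b := @stack_independent _ _ _ (P (set_sign b)) H (noise b) color
  (fun B => fine (normal_prob 0 1 B)) sH ndH mH colorH (@noise_hist b)
  (@noise_law b) (color_recurrent (set_sign b)).

Lemma measurable_stack_of b c n : measurable_fun setT (stack_of b c n).
Proof. exact: (measurable_stack sH ndH mH colorH (@noise_hist b) c n). Qed.

(** The first component of the sample point is the true sign, set to [b] by [test_prob b]: a test
    has the same random variables under both laws, whereas [noise] depends on the sign. *)
Definition tape (n : nat) (w : bool * T) : R := stack_of w.1 false n w.2.

(** Adding the drift back restores the actual observation of arm [j] in rounds before [tau]; later
    entries are standard noise with the right drift and keep the sequence infinite. *)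
Definition stream (n : nat) (w : bool * T) : R :=
  sgnb R w.1 * Delta + stack_of w.1 true n w.2.

Lemma measurable_tape n : measurable_fun setT (tape n).
Proof. apply: measurable_fun_bool_prod => b; exact: (measurable_stack_of b false n). Qed.

Lemma measurable_stream n : measurable_fun setT (stream n).
Proof.
apply: measurable_fun_bool_prod => b; apply: measurable_funD.
  exact: (measurable_cst (sgnb R b * Delta)).
exact: (measurable_stack_of b true n).
Qed.

Definition tape_events : set_system (bool * T) :=
  [set X | (exists2 B, measurable B & X = (U \o snd) @^-1` B) \/
           (exists n, exists2 B, measurable B & X = tape n @^-1` B)].

(* The randomization of the test is the whole sample point, seen through the
   sigma-algebra of the randomization and the off-arm noise. *)
Definition tapeT : measurableType _ := g_sigma_algebraType tape_events.

Definition read_tape (w : bool * T) : tapeT := w.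

Lemma tape_events_measurable : <<s tape_events>> `<=` measurable.
Proof.
apply: smallest_sub; first exact: measurable_sigma_algebra.
move=> X [[B mB ->]|[n [B mB ->]]].
  apply: preimage_measurable => //.
  by apply: measurableT_comp => //; exact: measurable_snd.
by apply: preimage_measurable => //; exact: measurable_tape.
Qed.

Lemma measurable_read_tape : measurable_fun setT read_tape.
Proof. by move=> _ B mB; rewrite setTI; exact: tape_events_measurable. Qed.

Lemma sigma_of_read_tape : sigma_of read_tape = <<s tape_events>>.
Proof.
apply/seteqP; split => X; first by case=> B mB <-; rewrite setTI.
by move=> sX; exists X => //; rewrite setTI.
Qed.

Definition pair_mfun (b : bool) : {mfun T >-> (bool * T)%type} :=
  mfun_Sub (mem_set (pair1_measurable b)).

Definition test_prob (b : bool) : probability (bool * T)%type R :=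
  distribution (P (set_sign b)) (pair_mfun b).

Lemma test_probE b X : test_prob b X = P (set_sign b) [set w | X (b, w)].
Proof. by []. Qed.

Definition rectangle (B : set E) (C K : nat -> set R) : set (bool * T) :=
  [set w | B (U w.2) /\
     (forall i, C i (tape i w)) /\ (forall i, K i (stream i w))].

Lemma rectangle_prob b N B C K : measurable B ->
  (forall i, measurable (C i)) -> (forall i, measurable (K i)) ->
  (forall i, (N <= i)%N -> C i = setT) -> (forall i, (N <= i)%N -> K i = setT) ->
  test_prob b (rectangle B C K) =
  (P (set_sign b) (U @^-1` B) *
   (\prod_(i < N) normal_prob (sgnb R b * Delta)%R 1%R (K i) *
    \prod_(i < N) normal_prob 0%R 1%R (C i)))%E.
Proof.
move=> mB mC mK CT KT; rewrite test_probE.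
(* The drift of the stream is moved into its constraint, so that both lists are tested as standard
   noise. *)
pose D c i := if c then (fun x => x + sgnb R b * Delta) @^-1` K i else C i.
have mD c i : measurable (D c i).
  by case: c => //=; exact: preimage_add_measurable.
rewrite (_ : mkset _ = U @^-1` B `&`
    [set w | forall c i, (i < N)%N -> D c i (stack_of b c i w)]).
  rewrite independence//; last exact: histmU.
  congr (_ * _)%E; rewrite EFinM -!prodEFin; congr (_ * _)%E.
    apply: eq_bigr => i _; rewrite [RHS]normal_prob_shift// fineK//.
    exact: (fin_num_measure (normal_prob 0 1) _ (mD true i)).
  apply: eq_bigr => i _; rewrite fineK//.
  exact: (fin_num_measure (normal_prob 0 1) _ (mD false i)).
apply/seteqP; split => w /=.
  move=> [Bw [Cw Kw]]; split => // -[] i iN; last exact: Cw.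
  by have := Kw i; rewrite /stream /= addrC.
move=> [Bw Dw]; split => //; split => i; (have [iN|Ni] := ltnP i N;
  last by rewrite ?CT ?KT).
  exact: (Dw false).
by have := Dw true i iN; rewrite /stream /= addrC.
Qed.

Lemma setI_closed_rectangle : setI_closed
  [set X | exists B C, [/\ measurable B, forall i, measurable (C i),
     exists N, forall i, (N <= i)%N -> C i = setT &
     X = rectangle B C (fun=> setT)] ].
Proof.
move=> _ _ [B [C [mB mC [N CN] ->]]] [B' [C' [mB' mC' [N' CN'] ->]]].
exists (B `&` B'), (fun i => C i `&` C' i); split.
- exact: measurableI.
- by move=> i; exact: measurableI.
- exists (maxn N N') => i; rewrite geq_max => /andP[Ni N'i].
  by rewrite CN// CN'// setTI.
- apply/seteqP; split => w /=.
    by move=> [[Bw [Cw _]] [B'w [C'w _]]].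
  move=> [[Bw B'w] [Cw _]]; split; split => //; split => // i;
    by have [] := Cw i.
Qed.

Lemma tape_events_rectangle : <<s tape_events>> `<=`
  <<s [set X | exists B C, [/\ measurable B, forall i, measurable (C i),
     exists N, forall i, (N <= i)%N -> C i = setT &
     X = rectangle B C (fun=> setT)] ]>>.
Proof.
apply: smallest_sub; first exact: smallest_sigma_algebra.
move=> X [[B mB ->]|[n [B mB ->]]]; apply: sub_sigma_algebra.
  exists B, (fun=> setT); split => //; first by exists 0%N.
  by apply/seteqP; split => w /= => [|[]].
exists setT, (fun i => if i == n then B else setT); split => //.
- by move=> i; case: ifP.
- by exists n.+1 => i ni; case: eqP => // E'; rewrite E' ltnn in ni.
- apply/seteqP; split => w /=.
    by move=> Bw; split => //; split => // i; case: eqP => // ->.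
  by move=> [_ [/(_ n)]]; rewrite eqxx.
Qed.

Lemma measurable_rectangle B C K : measurable B ->
  (forall i, measurable (C i)) -> (forall i, measurable (K i)) ->
  measurable (rectangle B C K).
Proof.
move=> mB mC mK; apply: measurableI.
  apply: (preimage_measurable (f := U \o snd)) => //.
  by apply: measurableT_comp => //; exact: measurable_snd.
apply: measurableI; apply: (sigma_countable_inter (measurable_sigma_algebra _)) => i.
  by apply: (preimage_measurable (f := tape i)) => //; exact: measurable_tape.
by apply: (preimage_measurable (f := stream i)) => //; exact: measurable_stream.
Qed.

(** Rectangles constraining the original randomization and finitely many tape entries form a
    pi-system generating the tape events; on them the factorization is [rectangle_prob]. *)
Lemma test_prob_tape b N X K : <<s tape_events>> X ->
  (forall i, measurable (K i)) -> (forall i, (N <= i)%N -> K i = setT) ->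
  test_prob b (X `&` [set w | forall i, K i (stream i w)]) =
  (test_prob b X * \prod_(i < N) normal_prob (sgnb R b * Delta)%R 1%R (K i))%E.
Proof.
move=> /tape_events_rectangle sX mK KN.
have rectT : rectangle setT (fun=> setT) K = [set w | forall i, K i (stream i w)].
  by apply/seteqP; split => w /= => [[_ []]|].
have -> : (\prod_(i < N) normal_prob (sgnb R b * Delta)%R 1%R (K i))%E =
    test_prob b [set w | forall i, K i (stream i w)].
  rewrite -rectT (rectangle_prob b (N := N))//.
  rewrite preimage_setT probability_setT mul1e [X in (_ * X)%E]big1 ?mule1//.
  by move=> i _; rewrite probability_setT.
move: X sX; apply: independent_pi_system.
- exact: setI_closed_rectangle.
- exists setT, (fun=> setT); split => //; first by exists 0%N.
  by apply/seteqP; split => w //=.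
- by move=> _ [B [C [mB mC _ ->]]]; exact: measurable_rectangle.
- by rewrite -rectT; exact: measurable_rectangle.
- move=> _ [B [C [mB mC [M CM] ->]]].
  rewrite -rectT.
  have -> : rectangle B C (fun=> setT) `&` rectangle setT (fun=> setT) K =
      rectangle B C K.
    by apply/seteqP; split => w /= => [[[? [? _]] [_ [_ ?]]]|[? [? ?]]].
  have KM i : (maxn M N <= i)%N -> K i = setT by rewrite geq_max => /andP[_ /KN].
  have CM' i : (maxn M N <= i)%N -> C i = setT by rewrite geq_max => /andP[/CM].
  rewrite !(rectangle_prob b (N := maxn M N))//.
  rewrite preimage_setT probability_setT mul1e.
  rewrite [X in (_ = _ * (X * _) * _)%E]big1; last first.
    by move=> i _; rewrite probability_setT.
  rewrite [X in (_ = _ * (_ * X))%E]big1; last first.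
    by move=> i _; rewrite probability_setT.
  by rewrite mul1e mule1 -muleA; apply: (f_equal2 mule erefl); exact: muleC.
Qed.

Lemma stream_law b n B : measurable B ->
  test_prob b (stream n @^-1` B) = normal_prob (sgnb R b * Delta) 1 B.
Proof.
move=> mB; pose K i := if i == n then B else setT.
have Kn : K n = B by rewrite /K eqxx.
have mK i : measurable (K i) by rewrite /K; case: ifP.
have KN i : (n.+1 <= i)%N -> K i = setT.
  by rewrite /K; case: eqP => // ->; rewrite ltnn.
have := test_prob_tape b (sigma_setT (smallest_sigma_algebra _ _)) mK KN.
rewrite probability_setT mul1e setTI big_ord_recr /= Kn big1 ?mul1e; last first.
  by move=> i _; rewrite /K lt_eqF ?probability_setT// ltEnat /=.
move=> <-; congr (test_prob b _); apply/seteqP; split => w /=.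
  by move=> Bw i; rewrite /K; case: eqP => // ->.
by move=> /(_ n); rewrite Kn.
Qed.

(** A rectangle that leaves the stream free has a probability in which the sign enters only through
    the law of [U], and that law is the same for all sign vectors. *)
Lemma tape_law X : <<s tape_events>> X -> test_prob true X = test_prob false X.
Proof.
move=> /tape_events_rectangle; move: X; apply: measure_eq_pi_system.
- exact: setI_closed_rectangle.
- exists setT, (fun=> setT); split => //; first by exists 0%N.
  by apply/seteqP; split => w //=.
- by move=> _ [B [C [mB mC _ ->]]]; exact: measurable_rectangle.
- by rewrite ltey_eq fin_num_measure.
- move=> _ [B [C [mB mC [N CN] ->]]].
  have rectE b : test_prob b (rectangle B C (fun=> setT)) =
      (P (set_sign b) (U @^-1` B) * \prod_(i < N) normal_prob 0%R 1%R (C i))%E.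
    rewrite (rectangle_prob b mB mC (fun=> measurableT) CN (fun _ _ => erefl)).
    rewrite [X in (_ * (X * _))%E]big1 ?mul1e// => i _.
    by rewrite probability_setT.
  apply: etrans (rectE true) _; apply: etrans _ (esym (rectE false)).
  by rewrite (lawU (set_sign true) (set_sign false) mB).
Qed.

(** A finite subfamily is completed by [setT] to one tape event together with constraints on the
    first [N] stream entries. *)
Lemma test_independent b : mutually_independent (test_prob b)
  (fun k : option nat => if k is Some n then sigma_of (stream n)
                         else sigma_of read_tape).
Proof.
move=> J B GB.
pose N := (\max_(k <- J) (if k is Some n then n.+1 else 0))%N.
have JN n : Some n \in J -> (n < N)%N.
  by move=> nJ; exact: (leq_bigmax_seq (Some n) nJ isT).
have Kex n : exists C, measurable C /\ (Some n \in J -> B (Some n) = stream n @^-1` C).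
  have [nJ|nJ] := boolP (Some n \in J); last by exists setT.
  by have [C mC <-] := GB _ nJ; exists C; split => //; rewrite setTI.
have {Kex}[K' K'P] := choice Kex.
pose K n := if Some n \in J then K' n else setT.
have mK n : measurable (K n) by rewrite /K; case: ifP => // _; case: (K'P n).
have KN n : (N <= n)%N -> K n = setT.
  by rewrite /K; case: ifP => // /JN; rewrite ltnNge => /negbTE ->.
pose X := if None \in J then B None else setT.
have sX : <<s tape_events>> X.
  rewrite /X; case: ifP => [/GB|_]; first by rewrite sigma_of_read_tape.
  exact: sigma_setT (smallest_sigma_algebra _ _).
have -> : \bigcap_(k in [set` J]) B k = X `&` [set w | forall i, K i (stream i w)].
  apply/seteqP; split => w.
    move=> Bw; split; first by rewrite /X; case: ifP => // nJ; exact: (Bw None).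
    move=> i; rewrite /K; case: ifP => // iJ.
    by have := Bw _ iJ; rewrite (K'P i).2.
  move=> [Xw Kw] [n|] /= nJ.
    by rewrite (K'P n).2//; have := Kw n; rewrite /K nJ.
  by move: Xw; rewrite /X nJ.
rewrite (test_prob_tape b sX mK KN).
pose s := None :: [seq Some i | i <- iota 0 N].
have us : uniq s.
  rewrite /s /= map_inj_uniq ?iota_uniq ?andbT; last by move=> ? ? [].
  by apply/mapP => -[].
have Js : perm_eq J [seq k <- s | k \in J].
  apply: uniq_perm; [exact: fset_uniq|exact: filter_uniq|].
  move=> k; rewrite mem_filter; case: (boolP (k \in J)) => //= kJ.
  case: k kJ => [n|] kJ; rewrite inE //=; apply/esym/mapP; exists n => //.
  by rewrite mem_iota /= add0n JN.
rewrite (perm_big _ Js) big_filter [RHS]big_mkcond big_cons big_map.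
congr (_ * _)%E.
  by rewrite /X; case: ifP => // _; rewrite probability_setT.
rewrite -[in RHS](subn0 N) -/(index_iota 0 N) big_mkord.
apply: eq_bigr => i _; rewrite /K; case: ifP => iJ; last by rewrite probability_setT.
by rewrite (K'P i).2// stream_law//; case: (K'P i).
Qed.

(** * From the history of the procedure to that of the test *)

Local Notation H' := (hist1 read_tape stream).

Let sH' n : sigma_algebra setT (H' n).
Proof. exact: hist1_sigma. Qed.

(** Says that [tau] is at least [t] or infinite; for positive [t] this is already known at time
    [t.-1]. *)
Definition reached (t : nat) (w : T) : bool :=
  if t is t'.+1 then ~~ le_time (tau w) t' else true.

Lemma reachedS t w : reached t.+1 w -> reached t w.
Proof.
case: t => // t /=; case: (tau w) => //= k; rewrite -!ltnNge; exact: ltnW.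
Qed.

Definition samples (t : nat) (w : T) : nat := occ (color ^~ w) true t.

Definition visible (t n : nat) : set (bool * T) :=
  [set w | reached t w.2 /\ (samples t w.2 <= n)%N].

Let HS t n : set T := [set w | ~~ le_time (tau w) t /\ (samples t.+1 w <= n)%N].

Let HHS t n : H t (HS t n).
Proof.
apply: (sigma_setI (sH t)); first exact: (not_stopped sH tau_stop).
rewrite (_ : (fun _ => _) = [set w | exists ak : nat * bool,
   ([set _ | (ak.1 + (ak.2 == true) <= n)%N] `&`
     ([set w | samples t w = ak.1] `&` [set w | color t w = ak.2])) w]).
  apply: (sigma_countable_union (sH t)) => -[a k].
  apply: (sigma_setI (sH t)); first exact: (sigma_cst (sH t)).
  apply: (sigma_setI (sH t)).
    exact: (occ_filtration sH ndH colorH).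
  exact: (color_filtration sH colorH).
apply/seteqP; split => w; rewrite /samples /=.
  by rewrite occS => le_n; exists (samples t w, color t w).
by move=> [[a k] /= [le_n [sa kw]]]; rewrite occS kw sa.
Qed.

(** Whether round [t] takes place and what colour it has are known before [Y t], so passing to
    [visible t.+1 n] adds a condition from [H t] only, which an induction on [t] can handle. *)
Let visibleS t n : visible t.+1 n = snd @^-1` HS t n `&` visible t n.
Proof.
apply/seteqP; split => w /=; last by case=> -[].
move=> [rw sw]; split => //; split; first exact: (@reachedS t).
by apply: leq_trans sw; rewrite /samples occS leq_addr.
Qed.

Lemma read_tape_hist n X : <<s tape_events>> X -> H' n X.
Proof.
by rewrite -sigma_of_read_tape => -[B mB <-]; rewrite setTI; exact: hist1U.
Qed.

Lemma tapeH i n B : measurable B -> H' n (tape i @^-1` B).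
Proof.
move=> mB; apply: read_tape_hist; apply: sub_sigma_algebra; right.
by exists i, B.
Qed.

(* What the procedure knows at time [t] can be read off the tape and the first
   [n] observations of the test, as long as at most [n] of them have been used. *)
Lemma visible_hist t n X : H t X -> H' n (snd @^-1` X `&` visible t n).
Proof.
elim: t X => [|t ih] X.
  have V0 : visible 0 n = setT.
    by apply/seteqP; split => // w _; split; rewrite // /samples occ0.
  move: X; apply: histm_sub => //=.
    by apply: sigma_trace => //; rewrite V0; exact: sigma_setT.
  move=> B mB; rewrite V0 setIT; apply: read_tape_hist.
  by apply: sub_sigma_algebra; left; exists B.
have HV : H' n (visible t.+1 n) by rewrite visibleS; exact: ih.
have old Y' : H t Y' -> H' n (snd @^-1` Y' `&` visible t.+1 n).
  move=> HY; rewrite visibleS setIA -preimage_setI; apply: ih.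
  exact: (sigma_setI (sH t)).
move: X; apply: histm_sub.
- exact: (sigma_trace (sH' n)).
- by move=> B mB; apply: old; exact: histmU.
- move=> i k it; apply: old; apply: (filtration_le ndH (m := i)) => //.
- move=> i B; rewrite ltnS leq_eqVlt => /predU1P[->|it] mB; last first.
    by apply: old; exact: histmY.
  (* [Y t] is the only new information. Once the arm and the number of earlier samples are fixed, it
     sits at a known place of the stream or of the tape. *)
  apply: (sigma_split (sH' n) (f := fun w => (A t w.2, samples t w.2))) => -[k a].
  have Hka : H' n (snd @^-1` ([set w | A t w = k] `&` [set w | samples t w = a])
      `&` visible t.+1 n).
    apply: old; apply: (sigma_setI (sH t)) => //.
    exact: (occ_filtration sH ndH colorH).
  have [kj|kj] := eqVneq k j.
    (* If [a >= n], sampling [j] in round [t] would bring the count to [a.+1 > n], contrary to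
       [visible t.+1 n]. *)
    have [an|na] := ltnP a n; last first.
      rewrite (_ : _ `&` _ = set0); first exact: (sigma_set0 (sH' n)).
      apply/seteqP; split => // -[b w] /= [[_ [rw sw]]] [Ak sa].
      move: sw; rewrite /samples occS /color (negbTE rw) Ak kj eqxx -/(samples t w) sa.
      by lia.
    rewrite (_ : _ `&` _ = stream a @^-1` B `&` (snd @^-1`
      ([set w | A t w = k] `&` [set w | samples t w = a]) `&` visible t.+1 n)).
      by apply: (sigma_setI (sH' n)) => //; exact: hist1Z.
    have streamE b w : A t w = k -> samples t w = a -> reached t.+1 w ->
        stream a (b, w) = Y t w.
      move=> Ak sa rw; rewrite /stream /stack_of /stack /= -sa slot_eq; last first.
        by rewrite /color (negbTE rw) Ak kj eqxx.
      by rewrite /noise Ak ffunE kj eqxx addrC subrK.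
    apply/seteqP; split => -[b w] /=.
      by move=> [[Bw vw] [Ak sa]]; rewrite streamE//; case: vw.
    by move=> [Bw [[Ak sa] vw]]; move: Bw; rewrite streamE// ?Ak ?sa//; case: vw.
  (* For [k != j] the mean is fixed by [r], so [Y t] is recovered from entry [t - a] of the tape,
     [t - a] being the number of earlier [false] rounds. *)
  pose C := (fun x => x + sgnb R (r k) * Delta) @^-1` B.
  have mC : measurable C by exact: preimage_add_measurable.
  rewrite (_ : _ `&` _ = tape (t - a) @^-1` C `&` (snd @^-1`
    ([set w | A t w = k] `&` [set w | samples t w = a]) `&` visible t.+1 n)).
    by apply: (sigma_setI (sH' n)) => //; exact: tapeH.
  have tapeE b w : A t w = k -> samples t w = a -> reached t.+1 w ->
      tape (t - a) (b, w) + sgnb R (r k) * Delta = Y t w.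
    move=> Ak sa rw; rewrite /tape /stack_of /stack /=.
    have -> : (t - a = occ (color ^~ w) false t)%N.
      by have := occC (color ^~ w) t; rewrite -/(samples t w) sa; lia.
    rewrite slot_eq; last by rewrite /color (negbTE rw) Ak; apply/negbTE.
    by rewrite /noise Ak ffunE (negbTE kj) subrK.
  apply/seteqP; split => -[b w] /=.
    by move=> [[Bw vw] [Ak sa]]; rewrite /C /= tapeE//; case: vw.
  move=> [Bw [[Ak sa] vw]]; move: Bw.
  by rewrite /C /= tapeE// ?Ak ?sa//; case: vw.
Qed.

Definition test_time (w : bool * T) : option nat :=
  if tau w.2 is Some t then Some (samples t w.2) else None.

Definition test_dec (w : bool * T) : bool := dec w.2.

Let reached_stop t w : tau w = Some t -> reached t w.
Proof. by case: t => [|t] //= ->; rewrite /= ltnn. Qed.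

(** The clock [t] of the procedure is unbounded when only [n] samples of [j] are taken, but each
    event [tau = Some t] is readable from [n] observations on [visible t n], and a countable union
    remains. *)
Lemma test_time_stop : stopping_time H' test_time.
Proof.
move=> n.
rewrite (_ : mkset _ = [set w | exists t,
    (snd @^-1` [set w | tau w = Some t] `&` visible t n) w]).
  apply: (sigma_countable_union (sH' n)) => t; apply: visible_hist.
  exact: (stopped_at sH ndH tau_stop).
apply/seteqP; split => w; rewrite /test_time /=.
  case tw : (tau w.2) => [t|] //= sn; exists t; split => //.
  by split => //; exact: reached_stop.
by move=> [t [-> [_ sn]]].
Qed.

Lemma test_dec_stop : measurable_wrt (stopped H' test_time) test_dec.
Proof.
apply: (stopped_decision sH' (@hist1_le _ _ _ _ _ _) test_time_stop).
- move=> w; rewrite /test_time /test_dec; case tw : (tau w.2) => [t|] // _.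
  exact: dec_none.
- move=> n; rewrite (_ : _ `&` _ = [set w | exists t,
    (snd @^-1` ([set w | dec w = false] `&` [set w | tau w = Some t]) `&`
     visible t n) w] `&` [set w | test_time w = Some n]).
    apply: (sigma_setI (sH' n)); last first.
      by apply: (stopped_at sH' _ test_time_stop) => k; exact: hist1_le.
    by apply: (sigma_countable_union (sH' n)) => t; exact: visible_hist.
  apply/seteqP; split => w /=.
    move=> [dw]; rewrite /test_time; case tw : (tau w.2) => [t|] //= [sn].
    split; last by rewrite sn.
    exists t; split=> //; split; last by rewrite sn.
    exact: (reached_stop tw).
  by move=> [[t [[dw _] _]]].
Qed.

Lemma test_lawU B : measurable B ->
  test_prob true (read_tape @^-1` B) = test_prob false (read_tape @^-1` B).
Proof. exact: tape_law. Qed.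

Definition arm_test : seq_test Delta :=
  @SeqTest R Delta _ _ test_prob _ _ read_tape stream test_time test_dec
    measurable_read_tape measurable_stream test_lawU
    (fun s n B => @stream_law s n B) test_independent test_time_stop test_dec_stop.

Definition arm_count (w : T) : nat := if tau w is Some t then
  (\sum_(i < t) (A i w == j))%N else 0%N.

Lemma test_timeE w : test_time w =
  if tau w.2 is Some _ then Some (arm_count w.2) else None.
Proof.
rewrite /test_time /arm_count; case tw : (tau w.2) => [t|] //; congr Some.
apply: eq_bigr => i _; rewrite /color tw /= leqNgt ltn_ord /=.
by case: (A i w.2 == j).
Qed.

Lemma arm_test_mean b : mean_time (test_prob b) test_time =
  (\int[P (set_sign b)]_w enat R (if tau w is Some _ then Some (arm_count w) else None))%E.
Proof.
rewrite /mean_time /test_prob /distribution ge0_integral_pushforward//=.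
- by apply: eq_integral => w _; rewrite /= test_timeE.
- apply: measurable_enat => n; apply: (@hist1_measurable _ _ _ _ _ _ _
    measurable_read_tape measurable_stream n).
  by apply: (stopped_at sH' _ test_time_stop) => k; exact: hist1_le.
- by move=> w _; exact: enat_ge0.
Qed.

End test_of_procedure.

(** * Summing over the arms and averaging over the signs *)

Lemma cost1_ge0 (R : realType) (Delta : R) (q : seq_test Delta) : (0 <= cost1 q)%E.
Proof. by rewrite mule_ge0 ?lee_fin ?invr_ge0// adde_ge0// mean_time_ge0. Qed.

Lemma C1_ge0 (R : realType) (alpha Delta : R) : (0 <= C1 alpha Delta)%E.
Proof. by apply: le_ereal_inf_tmp => _ [q [_ ->]]; exact: cost1_ge0. Qed.

Section ereal_sums.
Local Open Scope ereal_scope.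
Context {R : realType} {I : finType}.

Lemma sume_const (x : \bar R) : 0 <= x -> \sum_(i : I) x = (#|I|%:R)%:E * x.
Proof.
move=> x0; rewrite (eq_bigr (fun=> 1 * x)); last by move=> i _; rewrite mul1e.
by rewrite -ge0_sume_distrl// sumEFin sumr_const.
Qed.

Lemma half_add (x : \bar R) : 0 <= x -> (2^-1)%:E * (x + x) = x.
Proof.
move=> x0; rewrite ge0_muleDr// -ge0_muleDl ?lee_fin ?invr_ge0//.
by rewrite -EFinD (_ : (2^-1 + 2^-1 = 1)%R) ?mul1e//; lra.
Qed.

End ereal_sums.

(** Flipping coordinate [j] permutes the sign vectors, and the two values of [set_sign j s] are [s]
    and its flip. Thus the uniform average splits into two-point averages of the form occurring in
    [cost1]. *)
Lemma sum_signs_average (R : realType) (m : nat) (j : 'I_m)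
    (f : {ffun 'I_m -> bool} -> \bar R) : (forall s, 0 <= f s)%E ->
  (\sum_s f s = \sum_s (2^-1)%:E *
     (f (set_sign j s true) + f (set_sign j s false)))%E.
Proof.
move=> f0.
pose flip (s : {ffun 'I_m -> bool}) := [ffun k => if k == j then ~~ s k else s k].
have flipK : involutive flip.
  by move=> s; apply/ffunP => k; rewrite !ffunE; case: eqP => // _; rewrite negbK.
have signE s b : set_sign j s b = if s j == b then s else flip s.
  apply/ffunP => k; rewrite ffunE; case: (eqVneq k j) => [->|kj].
    by case: (eqVneq (s j) b) => [->//|]; rewrite ffunE eqxx; case: (s j) b => -[].
  by case: ifP => // _; rewrite ffunE (negbTE kj).
have pairE s : (f (set_sign j s true) + f (set_sign j s false) = f s + f (flip s))%E.
  by rewrite !signE; case: (s j) => //=; rewrite addeC.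
rewrite -ge0_sume_distrr; last by move=> s _; rewrite adde_ge0.
under [X in (_ = _ * X)%E]eq_bigr do rewrite pairE.
have flipE : (\sum_s f (flip s) = \sum_s f s)%E.
  by rewrite [RHS](reindex_inj (inv_inj flipK)).
by rewrite big_split /= flipE half_add// sume_ge0.
Qed.

Section arm_costs.
Context (R : realType) (m : nat) (Delta : R) (p : procedure m Delta).
Local Notation T := (pp_T p).
Local Notation H := (histm (@pp_U _ _ _ p) (@pp_A _ _ _ p) (@pp_Y _ _ _ p)).
Local Notation tau := (pp_tau p).

Let mH t : H t `<=` measurable.
Proof. exact: (histm_measurable (@pp_mU _ _ _ p) (@pp_mY _ _ _ p) (@pp_rule _ _ _ p)). Qed.

Let mtau n : measurable [set w | tau w = Some n].
Proof.
by apply: (@mH n); apply: (stopped_at _ _ (@pp_stop _ _ _ p)) => k;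
  [exact: histm_sigma|exact: histm_le].
Qed.

Let arm_mean (s : {ffun 'I_m -> bool}) (j : 'I_m) : \bar R :=
  (\int[pp_P p s]_w enat R
     (if tau w is Some _ then Some (arm_count (@pp_A _ _ _ p) tau j w) else None))%E.

Let arm_mean_ge0 s j : (0 <= arm_mean s j)%E.
Proof. by apply: integral_ge0 => w _; exact: enat_ge0. Qed.

(** The value [true] on [None] meets the constancy demanded by [stopped_decision]. *)
Let arm_decision (j : 'I_m) (w : T) : bool :=
  if tau w is None then true else pp_d p j (pp_S p w).

Let stopped_S B : measurable B ->
  stopped H tau ((fun w => pp_S p w) @^-1` B).
Proof. by move=> mB; apply: (@pp_mS _ _ _ p); exists B => //; rewrite setTI. Qed.

Lemma stopped_decoder j b :
  stopped H tau [set w | pp_d p j (pp_S p w) = b].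
Proof.
apply: (stopped_S (B := pp_d p j @^-1` [set b])).
exact: (preimage_measurable (@pp_md _ _ _ p j)).
Qed.

Lemma measurable_decoder j b : measurable [set w | pp_d p j (pp_S p w) = b].
Proof.
have [sH _] := stopped_decoder j b.
move: sH; apply: smallest_sub; first exact: measurable_sigma_algebra.
by move=> X [n _]; exact: mH.
Qed.

Let arm_decision_none j w : tau w = None -> arm_decision j w.
Proof. by rewrite /arm_decision => ->. Qed.

Let arm_decision_stop j n :
  H n ([set w | arm_decision j w = false] `&` [set w | tau w = Some n]).
Proof.
have [_ /(_ n) Hn] := stopped_decoder j false.
rewrite (_ : _ `&` _ = [set w | pp_d p j (pp_S p w) = false] `&`
  [set w | le_time (tau w) n] `&` [set w | tau w = Some n]).
  apply: (sigma_setI (histm_sigma _ _ _ _)) => //.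
  by apply: (stopped_at _ _ (@pp_stop _ _ _ p)) => k;
    [exact: histm_sigma|exact: histm_le].
rewrite /arm_decision; apply/seteqP; split => w /=.
  by move=> [dw tw]; rewrite tw /= in dw *.
by move=> [[dw _] tw]; rewrite tw.
Qed.

Let test_of (j : 'I_m) (s : {ffun 'I_m -> bool}) : seq_test Delta :=
  arm_test (@pp_mU _ _ _ p) (@pp_mY _ _ _ p) (@pp_lawU _ _ _ p)
    (@pp_rule _ _ _ p) (@pp_lawY _ _ _ p) (@pp_stop _ _ _ p) (@pp_fin _ _ _ p)
    (@arm_decision_none j) (@arm_decision_stop j) j s.

(** The error bound is used at the two vectors [set_sign j s b]. For the positive sign the default
    decision can only remove errors; for the negative sign it adds errors on a null event at
    most. *)
Let test_of_correct alpha j s : coordinatewise_correct alpha p ->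
  correct1 alpha (test_of j s).
Proof.
move=> /(_ j) err.
have {}err b : (pp_P p (set_sign j s b) [set w | pp_d p j (pp_S p w) = ~~ b]
    <= alpha%:E)%E.
  apply: le_trans err; apply: ereal_sup_ubound; exists (set_sign j s b) => //.
  congr (pp_P p _ _); rewrite ffunE eqxx.
  by apply/seteqP; split => w /=; case: b (pp_d _ _ _) => -[].
have mnone : measurable [set w | tau w = None].
  rewrite (_ : mkset _ = ~` [set w | exists n, tau w = Some n]).
    by apply: measurableC; exact: (sigma_countable_union (measurable_sigma_algebra _)).
  apply/seteqP; split => w /=; first by move=> ->; case.
  by case: (tau w) => // n []; exists n.
have testE b c : st_P (test_of j s) b [set w | st_dec (test_of j s) w = c] =
  pp_P p (set_sign j s b) [set w | arm_decision j w = c] by [].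
split; rewrite testE.
- apply: le_trans (err true).
  rewrite [leLHS](_ : _ = pp_P p (set_sign j s true)
    ([set w | pp_d p j (pp_S p w) = false] `\` [set w | tau w = None])).
    apply: le_measure; rewrite ?inE; last exact: subDsetl.
      by apply: measurableD => //; exact: measurable_decoder.
    exact: measurable_decoder.
  congr (pp_P p _ _); apply/seteqP; split => w; rewrite /arm_decision /=.
    by case: (tau w).
  by case: (tau w) => [n|] [].
- have null : pp_P p (set_sign j s false) [set w | tau w = None] = 0%E.
    have : (pp_P p (set_sign j s false)).-negligible [set w | tau w = None].
      have [N [mN N0 subN]] := @pp_fin _ _ _ p (set_sign j s false).
      by exists N; split => // w tw; apply: subN => /(_ tw).
    by move=> /measure_negligible; exact.
  apply: le_trans (err false).
  rewrite -[leRHS]add0e -null.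
  apply: le_trans (measureU2 _ mnone (measurable_decoder j true)).
  rewrite [leLHS](_ : _ = pp_P p (set_sign j s false) ([set w | tau w = None] `|`
    [set w | pp_d p j (pp_S p w) = true]))//.
  congr (pp_P p _ _); apply/seteqP; split => w; rewrite /arm_decision /=.
    by case: (tau w) => [n|]; [right|left].
  by case: (tau w) => [n|] [].
Qed.

Let arm_mean_lower alpha j s : coordinatewise_correct alpha p ->
  (C1 alpha Delta <= (2^-1)%:E *
     (arm_mean (set_sign j s true) j + arm_mean (set_sign j s false) j))%E.
Proof.
move=> corr; apply: ereal_inf_lbound; exists (test_of j s).
split; first exact: test_of_correct.
have meanE b : mean_time (st_P (test_of j s) b) (st_nu (test_of j s)) =
    arm_mean (set_sign j s b) j.
  exact: (arm_test_mean Delta (pp_P p) (@pp_mU _ _ _ p) (@pp_mY _ _ _ p)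
    (@pp_rule _ _ _ p) (@pp_stop _ _ _ p)).
by rewrite /cost1 !meanE.
Qed.

Let mean_time_arms s : (0 < m)%N ->
  mean_time (pp_P p s) tau = (\sum_(j < m) arm_mean s j)%E.
Proof.
move=> m0; rewrite /mean_time /arm_mean -ge0_integral_sum//.
- apply: eq_integral => w _; rewrite /arm_count; case: (tau w) => [t|] /=; last first.
    (* On [None] each summand is [+oo]; the existence of one arm makes the sum [+oo]. *)
    rewrite (bigD1 (Ordinal m0))//= addye// gt_eqF//.
    by apply: (@lt_le_trans _ _ 0%E) => //; apply: sume_ge0 => i _; rewrite leey.
  rewrite sumEFin -natr_sum; congr (_%:R%:E).
  rewrite exchange_big /= -[LHS]muln1 -[in LHS](card_ord t) -sum_nat_const.
  apply: eq_bigr => i _; rewrite (bigD1 (@pp_A _ _ _ p i w))//= eqxx big1// => k.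
  by rewrite eq_sym => /negbTE ->.
- move=> j; apply: measurable_enat => n.
  rewrite (_ : mkset _ = [set w | exists t, ([set w | tau w = Some t] `&`
      [set w | occ (fun i => @pp_A _ _ _ p i w == j) true t = n]) w]).
    apply: (sigma_countable_union (measurable_sigma_algebra _)) => t.
    apply: measurableI => //.
    apply: (@occ_filtration _ _ (fun=> measurable) (fun i w => @pp_A _ _ _ p i w == j)) => //.
      by move=> ?; exact: measurable_sigma_algebra.
      by move=> ? ?.
    move=> i; have := @mH i _ (@pp_rule _ _ _ p i j).
    congr (measurable _); apply/seteqP; split => w /=; last by move/eqP.
    by move=> ->; rewrite eqxx.
  have occE t w : occ (fun i => @pp_A _ _ _ p i w == j) true t = (\sum_(i < t) (@pp_A _ _ _ p i w == j))%N.
    by apply: eq_bigr => i _; case: (@pp_A _ _ _ p i w == j).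
  apply/seteqP; split => w; rewrite /arm_count /=.
    by case: (tau w) => [t|] // [<-]; exists t; split; rewrite // occE.
  by move=> [t [-> <-]]; rewrite occE.
- by move=> j w _; exact: enat_ge0.
Qed.

Lemma costm_lower alpha : (0 < m)%N -> coordinatewise_correct alpha p ->
  (m%:R%:E * C1 alpha Delta <= costm p)%E.
Proof.
move=> m0 corr; rewrite /costm.
rewrite (eq_bigr (fun s => \sum_(j < m) arm_mean s j)%E); last first.
  by move=> s _; exact: mean_time_arms.
rewrite exchange_big /= ge0_sume_distrr; last by move=> j _; exact: sume_ge0.
rewrite -[in leLHS](card_ord m) -sume_const ?C1_ge0//.
apply: lee_sum => j _; rewrite (@sum_signs_average _ _ j)//.
have C0 := C1_ge0 alpha Delta.
apply: (@le_trans _ _ ((2 ^- m)%:E * \sum_(s : {ffun 'I_m -> bool}) C1 alpha Delta)%E).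
  rewrite sume_const// card_ffun card_bool card_ord natrX muleA -EFinM.
  by rewrite mulVf ?mul1e// expf_neq0.
by rewrite lee_wpmul2l ?lee_fin ?invr_ge0 ?exprn_ge0//; apply: lee_sum => s _;
  exact: arm_mean_lower.
Qed.

End arm_costs.

(** * Upper bound: testing the coordinates one after the other *)

Section procedure_of_decisions.
Context d (T : measurableType d) (R : realType) (m : nat) (Delta : R)
  (P : {ffun 'I_m -> bool} -> probability T R)
  dU (E : measurableType dU) (U : T -> E)
  (A : nat -> T -> 'I_m) (Y : nat -> T -> R) (tau : T -> option nat)
  (dec : 'I_m -> T -> bool).
Local Notation H := (histm U A Y).
Hypothesis mU : measurable_fun setT U.
Hypothesis mY : forall t, measurable_fun setT (Y t).
Hypothesis lawU : forall s s' B, measurable B ->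
  P s (U @^-1` B) = P s' (U @^-1` B).
Hypothesis rule : forall t k, H t [set w | A t w = k].
Hypothesis arm_law : forall s t F B k, H t F -> measurable B ->
  (P s (F `&` [set w | A t w = k] `&` Y t @^-1` B) =
   normal_prob (sgnb R (s k) * Delta)%R 1%R B * P s (F `&` [set w | A t w = k]))%E.
Hypothesis tau_stop : stopping_time H tau.
Hypothesis tau_fin : forall s, {ae P s, forall w, tau w <> None}.
Hypothesis dec_none : forall j w, tau w = None -> dec j w.
Hypothesis dec_stop : forall j n,
  H n ([set w | dec j w = false] `&` [set w | tau w = Some n]).

Let sH t : sigma_algebra setT (H t).
Proof. exact: histm_sigma. Qed.

(* The most informative stopped element is the sample point itself, seen through
   the stopped sigma-algebra. *)
Definition stoppedT : measurableType _ := g_sigma_algebraType (stopped H tau).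

Definition reveal (w : T) : stoppedT := w.

Let stoppedE : <<s stopped H tau>> = stopped H tau.
Proof. exact/sigma_algebra_id/stopped_sigma_algebra. Qed.

Let mreveal : measurable_wrt (stopped H tau) reveal.
Proof.
have sub : <<s stopped H tau>> `<=` stopped H tau by rewrite stoppedE.
by apply: sigma_of_sub => B mB; exact: (sub B mB).
Qed.

Let mdec (j : 'I_m) : measurable_fun setT (dec j : stoppedT -> bool).
Proof.
move=> _ B mB; rewrite setTI.
apply: (sub_sigma_algebra (G := stopped H tau)).
apply: (stopped_decision sH (@histm_le _ _ _ _ _ _ _ _) tau_stop
  (@dec_none j) (@dec_stop j)).
exact: sigma_of_preimage.
Qed.

Let lawY s t F B : H t F -> measurable B ->
  P s (F `&` Y t @^-1` B) =
  (\int[P s]_(w in F) normal_prob (sgnb R (s (A t w)) * Delta)%R 1%R B)%E.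
Proof.
move=> HF mB.
apply: (integral_law_of_arm (A := A t) (G := H t)
  (law := fun k B => normal_prob (sgnb R (s k) * Delta) 1 B)) => //.
- exact: histm_measurable.
- by move=> G C k; exact: arm_law.
Qed.

Definition procedure_of_decisions : procedure m Delta :=
  @Procedure R m Delta _ T P _ E U A Y tau _ stoppedT reveal
    (fun j => dec j : stoppedT -> bool) mU mY lawU rule lawY tau_stop tau_fin mreveal mdec.

End procedure_of_decisions.

(** * Appending one test to a procedure on a product space *)

Section append_stage.
Context (R : realType) (m : nat) (Delta : R).
Context d1 (T1 : measurableType d1)
  (P1 : {ffun 'I_m -> bool} -> probability T1 R)
  dU1 (E1 : measurableType dU1) (U1 : T1 -> E1)
  (A1 : nat -> T1 -> 'I_m) (Y1 : nat -> T1 -> R) (tau1 : T1 -> option nat)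
  (dec1 : 'I_m -> T1 -> bool).
Local Notation H1 := (histm U1 A1 Y1).
Hypothesis mU1 : measurable_fun setT U1.
Hypothesis mY1 : forall t, measurable_fun setT (Y1 t).
Hypothesis lawU1 : forall s s' B, measurable B ->
  P1 s (U1 @^-1` B) = P1 s' (U1 @^-1` B).
Hypothesis rule1 : forall t k, H1 t [set w | A1 t w = k].
Hypothesis arm_law1 : forall s t F B k, H1 t F -> measurable B ->
  (P1 s (F `&` [set w | A1 t w = k] `&` Y1 t @^-1` B) =
   normal_prob (sgnb R (s k) * Delta)%R 1%R B * P1 s (F `&` [set w | A1 t w = k]))%E.
Hypothesis stop1 : stopping_time H1 tau1.
Hypothesis fin1 : forall s, {ae P1 s, forall w, tau1 w <> None}.
Hypothesis dec_stop1 : forall j n,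
  H1 n ([set w | dec1 j w = false] `&` [set w | tau1 w = Some n]).

Context d2 (T2 : measurableType d2) (P2 : bool -> probability T2 R)
  dU2 (E2 : measurableType dU2) (U2 : T2 -> E2) (Z : nat -> T2 -> R)
  (nu : T2 -> option nat) (dec2 : T2 -> bool).
Local Notation H2 := (hist1 U2 Z).
Hypothesis mU2 : measurable_fun setT U2.
Hypothesis mZ : forall t, measurable_fun setT (Z t).
Hypothesis lawU2 : forall b b' B, measurable B ->
  P2 b (U2 @^-1` B) = P2 b' (U2 @^-1` B).
Hypothesis law2 : forall b t F B, H2 t F -> measurable B ->
  (P2 b (F `&` Z t @^-1` B) =
   normal_prob (sgnb R b * Delta)%R 1%R B * P2 b F)%E.
Hypothesis stop2 : stopping_time H2 nu.
Hypothesis fin2 : forall b, {ae P2 b, forall w, nu w <> None}.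
Hypothesis dec_stop2 : forall n,
  H2 n ([set w | dec2 w = false] `&` [set w | nu w = Some n]).
Context (j0 : 'I_m).

Let sH1 t : sigma_algebra setT (H1 t). Proof. exact: histm_sigma. Qed.
Let sH2 t : sigma_algebra setT (H2 t). Proof. exact: hist1_sigma. Qed.
Let mH1 t : H1 t `<=` measurable.
Proof. exact: histm_measurable. Qed.
Let mH2 t : H2 t `<=` measurable.
Proof. exact: hist1_measurable. Qed.
Let ndH1 t : H1 t `<=` H1 t.+1. Proof. exact: histm_le. Qed.
Let ndH2 t : H2 t `<=` H2 t.+1. Proof. exact: hist1_le. Qed.

Definition join_U (w : T1 * T2) : E1 * E2 := (U1 w.1, U2 w.2).

Definition join_A (t : nat) (w : T1 * T2) : 'I_m :=
  if le_time (tau1 w.1) t then j0 else A1 t w.1.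

(** The clock of the test starts at [tau1]. The default of [odflt] is never reached, as
    [le_time None t] is false. *)
Definition join_Y (t : nat) (w : T1 * T2) : R :=
  if le_time (tau1 w.1) t then Z (t - odflt 0%N (tau1 w.1)) w.2 else Y1 t w.1.

Definition join_tau (w : T1 * T2) : option nat :=
  if tau1 w.1 is Some r then omap (addn r) (nu w.2) else None.

Definition join_dec (j : 'I_m) (w : T1 * T2) : bool :=
  if join_tau w is None then true
  else if j == j0 then dec2 w.2 else dec1 j w.1.

Definition join_P (s : {ffun 'I_m -> bool}) : probability (T1 * T2)%type R :=
  (P1 s \x P2 (s j0))%E.

Local Notation H := (histm join_U join_A join_Y).

Let sH t : sigma_algebra setT (H t). Proof. exact: histm_sigma. Qed.
Let ndH t : H t `<=` H t.+1. Proof. exact: histm_le. Qed.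

Lemma measurable_join_U : measurable_fun setT join_U.
Proof.
apply: measurable_fun_pair.
  by apply: measurableT_comp => //; exact: measurable_fst.
by apply: measurableT_comp => //; exact: measurable_snd.
Qed.

Let le_timeE o t : le_time o t -> exists2 r, o = Some r & (r <= t)%N.
Proof. by case: o => //= r; exists r. Qed.

Lemma measurable_join_Y t : measurable_fun setT (join_Y t).
Proof.
have mfst := @measurable_fst _ _ T1 T2; have msnd := @measurable_snd _ _ T1 T2.
move=> _ B mB; rewrite setTI.
apply: (sigma_split (measurable_sigma_algebra _) (f := fun w => tau1 w.1)) => o.
have mo : measurable (fst @^-1` [set w | tau1 w = o] : set (T1 * T2)).
  apply: preimage_measurable => //; case: o => [r|].
    by apply: (@mH1 r); exact: (stopped_at sH1 ndH1 stop1).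
  rewrite (_ : mkset _ = ~` [set w | exists n, tau1 w = Some n]).
    apply: measurableC; apply: (sigma_countable_union (measurable_sigma_algebra _)) => r.
    by apply: (@mH1 r); exact: (stopped_at sH1 ndH1 stop1).
  apply/seteqP; split => w /=; first by move=> ->; case.
  by case: (tau1 w) => // n []; exists n.
have [le_ot|Nle] := boolP (le_time o t).
  rewrite (_ : _ `&` _ = (Z (t - odflt 0%N o) \o snd) @^-1` B `&`
      fst @^-1` [set w | tau1 w = o]).
    apply: measurableI => //; apply: preimage_measurable => //.
    by apply: measurableT_comp.
  by apply/seteqP; split => w /= [+ oE]; rewrite /join_Y oE le_ot.
rewrite (_ : _ `&` _ = (Y1 t \o fst) @^-1` B `&` fst @^-1` [set w | tau1 w = o]).
  apply: measurableI => //; apply: preimage_measurable => //.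
  by apply: measurableT_comp.
by apply/seteqP; split => w /= [+ oE]; rewrite /join_Y oE (negbTE Nle).
Qed.

(** Choices and observations of the first stage are overwritten from [tau1] on, so its history
    survives only on the event [reached]. *)
Lemma join_hist1 t X : H1 t X ->
  H t (fst @^-1` X `&` [set w | reached tau1 t w.1]).
Proof.
elim: t X => [|t ih] X.
  have V0 : [set w : T1 * T2 | reached tau1 0 w.1] = setT.
    by apply/seteqP; split.
  move: X; apply: histm_sub => //=.
    by apply: (sigma_trace (sH 0)); rewrite V0; exact: (sigma_setT (sH 0)).
  move=> B mB; rewrite V0 setIT.
  rewrite (_ : _ @^-1` _ = join_U @^-1` (B `*` setT)).
    by apply: histmU; exact: measurableX.
  by apply/seteqP; split => w //= [].
have old X' : H1 t X' ->
    H t.+1 (fst @^-1` X' `&` [set w | reached tau1 t.+1 w.1]).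
  move=> HX'; apply: ndH.
  rewrite (_ : _ `&` _ = fst @^-1` (X' `&` [set w | ~~ le_time (tau1 w) t]) `&`
     [set w | reached tau1 t w.1]).
    apply: ih; apply: (sigma_setI (sH1 t)) => //.
    exact: (not_stopped sH1 stop1).
  apply/seteqP; split => w /=.
    by move=> [Xw rw]; split => //; exact: (@reachedS _ _ tau1 t w.1 rw).
  by move=> [[]].
have HV : H t.+1 [set w | reached tau1 t.+1 w.1].
  have := old _ (sigma_setT (sH1 t)); rewrite preimage_setT setTI; exact.
move: X; apply: histm_sub.
- exact: (sigma_trace (sH t.+1)).
- by move=> B mB; apply: old; exact: histmU.
- move=> i k it; apply: old; apply: (filtration_le ndH1 (m := i)) => //.
- move=> i B; rewrite ltnS leq_eqVlt => /predU1P[->|it] mB; last first.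
    by apply: old; exact: histmY.
  rewrite (_ : _ `&` _ = join_Y t @^-1` B `&` [set w | reached tau1 t.+1 w.1]).
    by apply: (sigma_setI (sH t.+1)) => //; exact: histmY.
  by apply/seteqP; split => w /= [+ rw]; rewrite /join_Y (negbTE rw).
Qed.

Lemma join_stopped_at X r : H1 r (X `&` [set w | tau1 w = Some r]) ->
  H r (fst @^-1` (X `&` [set w | tau1 w = Some r])).
Proof.
move=> /join_hist1; congr (H r _); apply/seteqP; split => w /=; first by case.
move=> [Xw tw]; split => //.
by case: r tw {Xw} => //= r ->; rewrite /= ltnn.
Qed.

Let HTr r : H r (fst @^-1` [set w | tau1 w = Some r]).
Proof.
have := @join_stopped_at setT r; rewrite setTI; apply.
exact: (stopped_at sH1 ndH1 stop1).
Qed.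

Let Hnot t X : H1 t X ->
  H t (fst @^-1` X `&` [set w | ~~ le_time (tau1 w.1) t]).
Proof.
move=> HX; have : H1 t (X `&` [set w | ~~ le_time (tau1 w) t]).
  by apply: (sigma_setI (sH1 t)) => //; exact: (not_stopped sH1 stop1).
move=> /join_hist1; congr (H t _); apply/seteqP; split => w /=; first by case=> -[].
move=> [Xw nw]; split => //; exact: (@reachedS _ _ tau1 t w.1 nw).
Qed.

Let Hle t : H t [set w | le_time (tau1 w.1) t].
Proof.
rewrite (_ : mkset _ = ~` [set w | ~~ le_time (tau1 w.1) t]).
  apply: (sigma_setC (sH t)).
  by have := Hnot (sigma_setT (sH1 t)); rewrite preimage_setT setTI.
by apply/seteqP; split => w /=; case: (le_time _ _).
Qed.

(** When [tau1 = Some r], the rounds from [r] to [r + n - 1] display [Z 0] up to [Z (n - 1)]. *)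
Lemma join_hist2 r n X : H2 n X ->
  H (r + n)%N (snd @^-1` X `&` fst @^-1` [set w | tau1 w = Some r]).
Proof.
have HT : H (r + n)%N (fst @^-1` [set w | tau1 w = Some r]).
  by apply: (filtration_le ndH (leq_addr n r)); exact: HTr.
move: X; apply: hist1_sub.
- exact: (sigma_trace (sH (r + n)%N)).
- move=> B mB; apply: (sigma_setI (sH (r + n)%N)) => //.
  rewrite (_ : _ @^-1` _ = join_U @^-1` (setT `*` B)).
    by apply: histmU; exact: measurableX.
  by apply/seteqP; split => w //= [].
- move=> i B lin mB.
  rewrite (_ : _ `&` _ = join_Y (r + i) @^-1` B `&` fst @^-1` [set w | tau1 w = Some r]).
    apply: (sigma_setI (sH (r + n)%N)) => //.
    by apply: histmY => //; rewrite ltn_add2l.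
  by apply/seteqP; split => w /= [+ tw]; rewrite /join_Y tw /= leq_addr addKn.
Qed.

Lemma join_rule t k : H t [set w | join_A t w = k].
Proof.
rewrite (_ : mkset _ = ([set w | le_time (tau1 w.1) t] `&` [set _ | j0 = k]) `|`
  (fst @^-1` [set w | A1 t w = k] `&` [set w | ~~ le_time (tau1 w.1) t])).
  apply: (sigma_setU (sH t)); last exact: Hnot.
  by apply: (sigma_setI (sH t)) => //; exact: (sigma_cst (sH t)).
apply/seteqP; split => w; rewrite /join_A /=.
  by case: (le_time _ _); [left|right].
by case: (le_time _ _) => -[] [].
Qed.

Lemma join_stop : stopping_time H join_tau.
Proof.
move=> n; rewrite (_ : mkset _ = [set w | exists r : 'I_n.+1,
   (snd @^-1` [set w | le_time (nu w) (n - r)] `&`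
    fst @^-1` [set w | tau1 w = Some (r : nat)]) w]).
  apply: (sigma_countable_union (sH n)) => r.
  have rn : (r + (n - r))%N = n by rewrite subnKC// -ltnS.
  have := @join_hist2 r (n - r)%N _ (@stop2 (n - r)%N); rewrite rn; exact.
apply/seteqP; split => w; rewrite /join_tau /=.
  case tw : (tau1 w.1) => [r|] //; case nw : (nu w.2) => [k|] //= rkn.
  have rn : (r < n.+1)%N by rewrite ltnS (leq_trans _ rkn)// leq_addr.
  by exists (Ordinal rn); split => //=; rewrite leq_subRL.
move=> [r [+ ->]]; case: (nu w.2) => //= k; rewrite leq_subRL//.
by rewrite -ltnS.
Qed.

Lemma join_dec_none j w : join_tau w = None -> join_dec j w.
Proof. by rewrite /join_dec => ->. Qed.

Lemma join_dec_stop j n :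
  H n ([set w | join_dec j w = false] `&` [set w | join_tau w = Some n]).
Proof.
rewrite (_ : _ `&` _ = [set w | exists r : 'I_n.+1,
   ((if j == j0 then snd @^-1` ([set w | dec2 w = false] `&`
                       [set w | nu w = Some (n - r)%N])
     else fst @^-1` ([set w | dec1 j w = false] `&`
                       [set w | tau1 w = Some (r : nat)]) `&`
          snd @^-1` [set w | nu w = Some (n - r)%N]) `&`
    fst @^-1` [set w | tau1 w = Some (r : nat)]) w]).
  apply: (sigma_countable_union (sH n)) => r.
  have rn : (r + (n - r))%N = n by rewrite subnKC// -ltnS.
  case: ifP => _.
    by have := @join_hist2 r (n - r)%N _ (@dec_stop2 (n - r)%N); rewrite rn; exact.
  rewrite -setIA; apply: (sigma_setI (sH n)).
    apply: (filtration_le ndH (m := r)); first by rewrite -ltnS.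
    exact: join_stopped_at.
  have := @join_hist2 r (n - r)%N _ (stopped_at sH2 ndH2 stop2 (n - r)%N).
  by rewrite rn; exact.
apply/seteqP; split => w; rewrite /join_dec /join_tau /=.
  case tw : (tau1 w.1) => [r|] [] //; case nw : (nu w.2) => [k|] //= dw [rkn].
  have rn : (r < n.+1)%N by rewrite ltnS -rkn leq_addr.
  exists (Ordinal rn); have -> : (n - r)%N = k by rewrite -rkn addKn.
  by move: dw; case: (j == j0).
move=> [r [+ tw]].
have rn : (r + (n - r))%N = n by rewrite subnKC// -ltnS.
by case: (j == j0) => /= [[dw nw]|[[dw _] nw]]; rewrite tw nw /= rn.
Qed.

(** With the second coordinate frozen and the first stage still running, the joint history reduces
    to that of the first stage. *)
Let section1 w2 t F : H t F ->
  H1 t ((fun w1 => (w1, w2)) @^-1` F `&` [set w1 | ~~ le_time (tau1 w1) t]).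
Proof.
have HN : H1 t [set w1 | ~~ le_time (tau1 w1) t] := not_stopped sH1 stop1 t.
have Nle i w1 : (i < t)%N -> ~~ le_time (tau1 w1) t -> le_time (tau1 w1) i = false.
  by case: (tau1 w1) => //= r it; rewrite -ltnNge => /(ltn_trans it); rewrite ltnNge => /negbTE.
move: F; apply: histm_sub.
- exact: (sigma_trace (sH1 t)).
- move=> B mB; apply: (sigma_setI (sH1 t)) => //.
  apply: (histmU (U := U1) (B := (fun x => (x, U2 w2)) @^-1` B)).
  by apply: preimage_measurable => //; exact: pair2_measurable.
- move=> i k it; rewrite (_ : _ `&` _ = [set w | A1 i w = k] `&`
    [set w1 | ~~ le_time (tau1 w1) t]).
    apply: (sigma_setI (sH1 t)) => //.
    by apply: (filtration_le ndH1 (ltnW it)); exact: rule1.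
  by apply/seteqP; split => w /= [+ nw]; rewrite /join_A /= (Nle i).
- move=> i B it mB; rewrite (_ : _ `&` _ = Y1 i @^-1` B `&`
    [set w1 | ~~ le_time (tau1 w1) t]).
    by apply: (sigma_setI (sH1 t)) => //; exact: histmY.
  by apply/seteqP; split => w /= [+ nw]; rewrite /join_Y /= (Nle i).
Qed.

(** With the first coordinate frozen, all first-stage data are constants and only the first [t - r]
    observations of the test vary. *)
Let section2 w1 r t F : tau1 w1 = Some r -> (r <= t)%N -> H t F ->
  H2 (t - r) ((fun w2 => (w1, w2)) @^-1` F).
Proof.
move=> tw rt; move: F.
have sG : sigma_algebra setT [set F | H2 (t - r) ((fun w2 => (w1, w2)) @^-1` F)].
  have := sigma_trace (sH2 (t - r)) (fun w2 => (w1, w2)) (sigma_setT (sH2 (t - r))).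
  by congr (sigma_algebra _ _); apply/funext => F /=; rewrite setIT.
apply: histm_sub => //.
- move=> B mB; apply: (hist1U (B := (fun x => (U1 w1, x)) @^-1` B)).
  by apply: preimage_measurable => //; exact: pair1_measurable.
- move=> i k it.
  exact: (sigma_cst (sH2 (t - r)) ((if le_time (tau1 w1) i then j0 else A1 i w1) = k)).
- move=> i B it mB /=; have [ri|ir] := leqP r i.
    rewrite (_ : _ @^-1` _ = Z (i - r) @^-1` B).
      by apply: hist1Z => //; move: it ri; clear; lia.
    by apply/seteqP; split => w2; rewrite /join_Y /= tw /= ri.
  rewrite (_ : _ @^-1` _ = [set _ | B (Y1 i w1)]); first exact: (sigma_cst (sH2 _)).
  by apply/seteqP; split => w2; rewrite /join_Y /= tw /= leqNgt ir.
Qed.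

Let mH t : H t `<=` measurable.
Proof.
by apply: histm_measurable; [exact: measurable_join_U|exact: measurable_join_Y|
  exact: join_rule].
Qed.

(** Allows the inner integral to run over either factor, namely the one whose conditional law
    governs the round in question. *)
Lemma join_P_swap s X : measurable X -> join_P s X = (P1 s \x^ P2 (s j0))%E X.
Proof.
move=> mX; apply: product_measure_unique => // B C mB mC.
exact: product_measure2E.
Qed.

(** For fixed [w1] the section of [F] is a test history at time [t - r], and round [t] shows the
    fresh observation [Z (t - r)]. *)
Let law_stopped s t F B : H t F -> measurable B ->
  (join_P s (F `&` [set w | le_time (tau1 w.1) t] `&` join_Y t @^-1` B) =
   normal_prob (sgnb R (s j0) * Delta)%R 1%R B *
   join_P s (F `&` [set w | le_time (tau1 w.1) t]))%E.
Proof.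
move=> HF mB.
have mFL : measurable (F `&` [set w | le_time (tau1 w.1) t]).
  by apply: (@mH t); apply: (sigma_setI (sH t)).
rewrite /join_P /= /product_measure1 -ge0_integralZl//; last first.
- exact: measurable_fun_xsection.
apply: eq_integral => w1 _ /=.
rewrite !xsectionE.
have [le_t|Nle] := boolP (le_time (tau1 w1) t).
  have [r tw rt] := le_timeE le_t.
  have FL : (fun w2 => (w1, w2)) @^-1` (F `&` [set w | le_time (tau1 w.1) t]) =
      (fun w2 => (w1, w2)) @^-1` F.
    by apply/seteqP; split => w2 //= [].
  have YZ : (fun w2 => (w1, w2)) @^-1` (join_Y t @^-1` B) = Z (t - r) @^-1` B.
    by apply/seteqP; split => w2; rewrite /join_Y /= tw /= rt.
  by rewrite preimage_setI FL YZ law2//; exact: section2.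
have FL : (fun w2 => (w1, w2)) @^-1` (F `&` [set w | le_time (tau1 w.1) t]) = set0.
  by apply/seteqP; split => // w2 [_ /=]; rewrite (negbTE Nle).
by rewrite preimage_setI FL set0I !measure0 mule0.
Qed.

(** Here the second coordinate is fixed instead, and [arm_law1] applies to the section. *)
Let law_running s t F B k : H t F -> measurable B ->
  (join_P s (F `&` [set w | ~~ le_time (tau1 w.1) t] `&` [set w | A1 t w.1 = k] `&`
      join_Y t @^-1` B) =
   normal_prob (sgnb R (s k) * Delta)%R 1%R B *
   join_P s (F `&` [set w | ~~ le_time (tau1 w.1) t] `&` [set w | A1 t w.1 = k]))%E.
Proof.
move=> HF mB.
have HFN : H t (F `&` [set w | ~~ le_time (tau1 w.1) t] `&` [set w | A1 t w.1 = k]).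
  rewrite -setIA; apply: (sigma_setI (sH t)) => //.
  by rewrite setIC; exact: (Hnot (@rule1 t k)).
have mFN := @mH t _ HFN.
rewrite !join_P_swap//; last first.
  by apply: measurableI => //; exact: (preimage_measurable (measurable_join_Y t)).
rewrite /product_measure2 -ge0_integralZl//; last first.
- exact: measurable_fun_ysection.
apply: eq_integral => w2 _ /=.
rewrite !ysectionE -(arm_law1 s k (section1 w2 HF) mB).
congr (P1 s _); apply/seteqP; split => w1 /= [] [[Fw nw] Aw];
  by rewrite /join_Y /= (negbTE nw).
Qed.

Lemma join_arm_law s t F B k : H t F -> measurable B ->
  (join_P s (F `&` [set w | join_A t w = k] `&` join_Y t @^-1` B) =
   normal_prob (sgnb R (s k) * Delta)%R 1%R B *
   join_P s (F `&` [set w | join_A t w = k]))%E.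
Proof.
move=> HF mB.
pose L := [set w : T1 * T2 | le_time (tau1 w.1) t].
pose N := [set w : T1 * T2 | ~~ le_time (tau1 w.1) t].
have HFA : H t (F `&` [set w | join_A t w = k]).
  by apply: (sigma_setI (sH t)) => //; exact: join_rule.
have HN : H t N by have := Hnot (sigma_setT (sH1 t)); rewrite preimage_setT setTI.
have mL : measurable L := @mH t _ (@Hle t).
have mN : measurable N := @mH t _ HN.
have splitLN X : measurable X -> join_P s X = (join_P s (X `&` L) + join_P s (X `&` N))%E.
  move=> mX; rewrite -measureU; [|exact: measurableI|exact: measurableI|].
    rewrite -setIUr (_ : L `|` N = setT) ?setIT//.
    by apply/seteqP; split => // w _; rewrite /L /N /=; case: le_time; [left|right].
  apply/seteqP; split => // w [[_ Lw] [_ Nw]]; move: Lw Nw; rewrite /L /N /=.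
  by case: le_time.
have mY : measurable (join_Y t @^-1` B).
  by apply: preimage_measurable => //; exact: measurable_join_Y.
rewrite [LHS]splitLN; last by apply: measurableI => //; exact: (@mH t _ HFA).
rewrite [in RHS]splitLN; last exact: (@mH t _ HFA).
rewrite ge0_muleDr//; congr (_ + _)%E.
  rewrite [X in join_P s X = _]setIAC [LHS](@law_stopped s t _ B HFA mB).
  (* After the first stage only [j0] is sampled, so for other arms both sides vanish. *)
  have [->//|kj] := eqVneq k j0.
  rewrite (_ : F `&` _ `&` _ = set0); first by rewrite measure0 !mule0.
  apply/seteqP; split => // w [[_ /=]]; rewrite /join_A => Ak le_t.
  by move: Ak; rewrite le_t => E; rewrite E eqxx in kj.
rewrite [X in join_P s X = _]setIAC.
rewrite (_ : F `&` _ `&` N = F `&` N `&` [set w | A1 t w.1 = k]).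
  exact: law_running.
by apply/seteqP; split => w /= [[Fw + +]]; rewrite /N /join_A /= => a b;
  [rewrite (negbTE b) in a|rewrite (negbTE a)].
Qed.

(** The laws of the two factors are exchanged one at a time, each on sections along the other
    coordinate. *)
Lemma join_lawU s s' B : measurable B ->
  join_P s (join_U @^-1` B) = join_P s' (join_U @^-1` B).
Proof.
move=> mB.
have mX : measurable (join_U @^-1` B).
  by apply: preimage_measurable => //; exact: measurable_join_U.
have fix2 r : join_P r (join_U @^-1` B) = (P1 r \x P2 (s j0))%E (join_U @^-1` B).
  rewrite /join_P /= /product_measure1; apply: eq_integral => w1 _ /=.
  rewrite xsectionE.
  apply: (@lawU2 _ _ ((fun x => (U1 w1, x)) @^-1` B)); apply: preimage_measurable => //; exact: pair1_measurable.
have swap r : (P1 r \x P2 (s j0))%E (join_U @^-1` B) =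
    (P1 r \x^ P2 (s j0))%E (join_U @^-1` B).
  by apply: product_measure_unique => // C D mC mD; exact: product_measure2E.
rewrite !fix2 !swap /product_measure2; apply: eq_integral => w2 _ /=.
rewrite ysectionE.
apply: (@lawU1 _ _ ((fun x => (x, U2 w2)) @^-1` B)); apply: preimage_measurable => //; exact: pair2_measurable.
Qed.

Lemma join_P_fst s X : measurable X -> join_P s (fst @^-1` X) = P1 s X.
Proof.
move=> mX; rewrite (_ : _ @^-1` _ = X `*` setT); last first.
  by apply/seteqP; split => w //= [].
transitivity (P1 s X * P2 (s j0) setT)%E; first exact: product_measure1E.
by rewrite probability_setT mule1.
Qed.

Lemma join_P_snd s X : measurable X -> join_P s (snd @^-1` X) = P2 (s j0) X.
Proof.
move=> mX; rewrite (_ : _ @^-1` _ = setT `*` X); last first.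
  by apply/seteqP; split => w //= [].
transitivity (P1 s setT * P2 (s j0) X)%E; first exact: product_measure1E.
by rewrite probability_setT mul1e.
Qed.

Lemma join_fin s : {ae join_P s, forall w, join_tau w <> None}.
Proof.
have [N1 [mN1 PN1 sub1]] := fin1 s; have [N2 [mN2 PN2 sub2]] := fin2 (s j0).
apply: (@negligibleS _ _ _ _ (fst @^-1` N1 `|` snd @^-1` N2)).
  move=> w /= Nw; apply: contrapT => /not_orP[n1 n2]; apply: Nw.
  have t1 : tau1 w.1 <> None by apply: contrapT => t1; apply: n1; exact: sub1.
  have t2 : nu w.2 <> None by apply: contrapT => t2; apply: n2; exact: sub2.
  by rewrite /join_tau; case: (tau1 w.1) t1 => // r _; case: (nu w.2) t2.
apply: negligibleU.
- exists (fst @^-1` N1); split => //; last by rewrite -PN1; exact: join_P_fst.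
  by apply: preimage_measurable => //; exact: measurable_fst.
- exists (snd @^-1` N2); split => //; last by rewrite -PN2; exact: join_P_snd.
  by apply: preimage_measurable => //; exact: measurable_snd.
Qed.

Lemma join_mean s : mean_time (join_P s) join_tau =
  (mean_time (P1 s) tau1 + mean_time (P2 (s j0)) nu)%E.
Proof.
have m1 : measurable_fun setT (fun w => enat R (tau1 w)).
  apply: measurable_enat => n; apply: (@mH1 n); exact: (stopped_at sH1 ndH1 stop1).
have m2 : measurable_fun setT (fun w => enat R (nu w)).
  apply: measurable_enat => n; apply: (@mH2 n); exact: (stopped_at sH2 ndH2 stop2).
have mfst := @measurable_fst _ _ T1 T2; have msnd := @measurable_snd _ _ T1 T2.
rewrite /mean_time.
transitivity (\int[join_P s]_w (enat R (tau1 w.1) + enat R (nu w.2)))%E.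
  apply: eq_integral => w _; rewrite /join_tau.
  case: (tau1 w.1) => [r|] /=; last by rewrite addye// gt_eqF// (lt_le_trans _ (enat_ge0 _ _)).
  by case: (nu w.2) => [k|] /=; rewrite ?addey// natrD.
rewrite ge0_integralD//; first last.
- exact: (measurableT_comp m2 msnd).
- by move=> w _; exact: enat_ge0.
- exact: (measurableT_comp m1 mfst).
- by move=> w _; exact: enat_ge0.
congr (_ + _)%E.
- rewrite -[LHS](ge0_integral_pushforward mfst (join_P s) (D := setT)
    (f := fun w => enat R (tau1 w)))//; last by move=> w _; exact: enat_ge0.
  by apply: eq_measure_integral => X mX _; exact: join_P_fst.
- rewrite -[LHS](ge0_integral_pushforward msnd (join_P s) (D := setT)
    (f := fun w => enat R (nu w)))//; last by move=> w _; exact: enat_ge0.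
  by apply: eq_measure_integral => X mX _; exact: join_P_snd.
Qed.

Hypothesis mdec1 : forall j b, measurable [set w | dec1 j w = b].
Hypothesis mdec2 : forall b, measurable [set w | dec2 w = b].

(** The default decision on [None] may add errors, but [join_fin] makes that event null. *)
Lemma join_error s j : (join_P s [set w | join_dec j w <> s j] <=
  if j == j0 then P2 (s j0) [set w | dec2 w <> s j0]
  else P1 s [set w | dec1 j w <> s j])%E.
Proof.
pose none := [set w | join_tau w = None].
have mnone : measurable none.
  rewrite (_ : none = ~` [set w | exists n, join_tau w = Some n]).
    apply: measurableC; apply: (sigma_countable_union (measurable_sigma_algebra _)) => n.
    by apply: (@mH n); exact: (stopped_at sH ndH join_stop).
  apply/seteqP; split => w; rewrite /none /=; first by move=> ->; case.
  by case: (join_tau w) => // n []; exists n.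
have none0 : join_P s none = 0%E.
  have : (join_P s).-negligible none.
    have [N [mN N0 subN]] := join_fin s.
    by exists N; split => // w tw; apply: subN => /(_ tw).
  by move=> /measure_negligible; exact.
have neE (b b' : bool) : (b <> b') <-> (b = ~~ b').
  by case: b b' => -[]; split.
pose X : set (T1 * T2) := if j == j0 then snd @^-1` [set w | dec2 w <> s j0]
  else fst @^-1` [set w | dec1 j w <> s j].
have ne2 : [set w | dec2 w <> s j0] = [set w | dec2 w = ~~ s j0].
  by apply/seteqP; split => w /= /neE.
have ne1 : [set w | dec1 j w <> s j] = [set w | dec1 j w = ~~ s j].
  by apply/seteqP; split => w /= /neE.
have mX : measurable X.
  rewrite /X; case: ifP => _; rewrite ?ne1 ?ne2.
    by apply: (preimage_measurable (@measurable_snd _ _ T1 T2)).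
  by apply: (preimage_measurable (@measurable_fst _ _ T1 T2)).
rewrite [leRHS](_ : _ = join_P s X); last first.
  rewrite /X; case: ifP => _; rewrite ?ne1 ?ne2.
    by rewrite join_P_snd.
  by rewrite join_P_fst.
rewrite -[leRHS]add0e -none0; apply: le_trans (measureU2 _ mnone mX).
apply: le_measure; rewrite ?inE; last 2 first.
- exact: measurableU.
- move=> w; rewrite /join_dec /X /none /=.
  case: (join_tau w) => [n|]; last by left.
  by case: (eqVneq j j0) => [->|_]; right.
rewrite (_ : mkset _ = (none `&` [set _ | true <> s j]) `|` (X `\` none)).
  apply: measurableU; last exact: measurableD.
  by apply: measurableI => //; exact: (sigma_cst (measurable_sigma_algebra _)).
apply/seteqP; split => w; rewrite /join_dec /X /none /=.
  case: (join_tau w) => [n|]; last by left.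
  by case: (eqVneq j j0) => [->|_]; right.
case: (join_tau w) => [n|] [[]|[]] //.
by case: (eqVneq j j0) => [->|_].
Qed.

Definition join_procedure : procedure m Delta :=
  procedure_of_decisions measurable_join_U measurable_join_Y join_lawU join_rule
    join_arm_law join_stop join_fin join_dec_none join_dec_stop.

End append_stage.

(** * Induction over the coordinates *)

Section sequential_procedure.
Context (R : realType) (Delta alpha : R) (q : seq_test Delta).
Hypothesis q_correct : correct1 alpha q.
Hypothesis q_cost : (cost1 q < +oo)%E.
Local Notation T := (st_T q).
Local Notation H := (hist1 (@st_U _ _ q) (@st_Z _ _ q)).

Let mU : measurable_fun setT (@st_U _ _ q) := @st_mU _ _ q.
Let mZ : forall n, measurable_fun setT (@st_Z _ _ q n) := @st_mZ _ _ q.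

Let sH t : sigma_algebra setT (H t). Proof. exact: hist1_sigma. Qed.
Let ndH t : H t `<=` H t.+1. Proof. exact: hist1_le. Qed.
Let mH t : H t `<=` measurable. Proof. exact: hist1_measurable. Qed.

Let lawU b b' B : measurable B ->
  st_P q b ((@st_U _ _ q) @^-1` B) = st_P q b' ((@st_U _ _ q) @^-1` B).
Proof. by move=> mB; have := st_lawU mB; case: b b' => -[]. Qed.

Let lawZ b t F B : H t F -> measurable B ->
  (st_P q b (F `&` (@st_Z _ _ q) t @^-1` B) =
   normal_prob (sgnb R b * Delta)%R 1%R B * st_P q b F)%E.
Proof.
move=> HF mB; rewrite (independent_next mU mZ (@st_indep _ _ q b) HF mB).
by rewrite st_lawZ// muleC.
Qed.

Let decH b : stopped H (st_nu q) [set w | st_dec q w = b].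
Proof.
by apply: (@st_mdec _ _ q); exists [set b] => //; rewrite setTI.
Qed.

Let dec_stop n :
  H n ([set w | st_dec q w = false] `&` [set w | st_nu q w = Some n]).
Proof.
have [_ /(_ n) Hn] := decH false.
rewrite (_ : _ `&` _ = [set w | st_dec q w = false] `&`
  [set w | le_time (st_nu q w) n] `&` [set w | st_nu q w = Some n]).
  by apply: (sigma_setI (sH n)) => //; exact: (stopped_at sH ndH (@st_stop _ _ q)).
by apply/seteqP; split => w /=; [case=> -> ->; rewrite /= leqnn|case=> -[-> _] ->].
Qed.

Let mdec b : measurable [set w | st_dec q w = b].
Proof.
have [sdec _] := decH b; move: sdec.
apply: smallest_sub; first exact: measurable_sigma_algebra.
by move=> X [n _]; exact: mH.
Qed.

(** A finite average of two nonnegative means forces both to be finite; integrability then gives the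
    almost sure stopping that a procedure must satisfy. *)
Let mean_fin b : (mean_time (st_P q b) (st_nu q) < +oo)%E.
Proof.
have m0 b' := mean_time_ge0 (st_P q b') (st_nu q).
move: q_cost; rewrite /cost1; apply: contraTT; rewrite -!leNgt !leye_eq => /eqP moo.
rewrite [X in (_ * X)%E](_ : _ = +oo%E); first by rewrite gt0_muley// lte_fin invr_gt0.
by case: b moo => ->; [rewrite addye|rewrite addey]; rewrite // gt_eqF// (lt_le_trans _ (m0 _)).
Qed.

Let nu_fin b : {ae st_P q b, forall w, st_nu q w <> None}.
Proof.
have mnu : measurable_fun setT (fun w => enat R (st_nu q w)).
  apply: measurable_enat => n; apply: (@mH n).
  exact: (stopped_at sH ndH (@st_stop _ _ q)).
have : (st_P q b).-integrable setT (fun w => enat R (st_nu q w)).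
  apply/integrableP; split => //.
  under eq_integral do rewrite gee0_abs ?enat_ge0//.
  exact: mean_fin.
move=> /(integrable_ae measurableT); apply: filterS => w /(_ Logic.I).
by case: (st_nu q w).
Qed.

Let q_error b : (st_P q b [set w | st_dec q w <> b] <= alpha%:E)%E.
Proof.
have [e1 e2] := q_correct.
by case: b; [apply: le_trans e1|apply: le_trans e2];
  apply: le_measure; rewrite ?inE //;
  [rewrite (_ : mkset _ = [set w | st_dec q w = false])//|move=> w /=|
   rewrite (_ : mkset _ = [set w | st_dec q w = true])//|move=> w /=];
  try (by apply/seteqP; split => w /=; case: (st_dec q w)); case: (st_dec q w).
Qed.

Variable (m : nat).

(** Induction invariant: no error bound is asked of coordinates from [k] on, while the mean time is
    exact under each sign vector. *)
Let staged (k : nat) := exists p : procedure m Delta,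
  (forall s (j : 'I_m), (j < k)%N ->
     (pp_P p s [set w | pp_d p j (pp_S p w) <> s j] <= alpha%:E)%E) /\
  (forall s, mean_time (pp_P p s) (pp_tau p) =
     (\sum_(j < m | (j < k)%N) mean_time (st_P q (s j)) (st_nu q))%E).

(** A procedure that stops at once must still carry observations with the right laws; a copy of the
    space of the test, with arm [j0] sampled at all times, supplies them. *)
Lemma first_stage (j0 : 'I_m) : staged 0.
Proof.
pose A (t : nat) (w : T) := j0.
pose tau (w : T) := Some 0%N.
have sHm t : sigma_algebra setT (histm (@st_U _ _ q) A (@st_Z _ _ q) t).
  exact: histm_sigma.
have Hm_sub t : histm (@st_U _ _ q) A (@st_Z _ _ q) t `<=` H t.
  apply: histm_sub => //.
  - by move=> B; exact: hist1U.
  - by move=> i k it; exact: (sigma_cst (sH t) (j0 = k)).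
  - by move=> i B it mB; exact: hist1Z.
have ruleA t k : histm (@st_U _ _ q) A (@st_Z _ _ q) t [set w | A t w = k].
  exact: (sigma_cst (sHm t) (j0 = k)).
have armA s t F B k : histm (@st_U _ _ q) A (@st_Z _ _ q) t F -> measurable B ->
  (st_P q (s j0) (F `&` [set w | A t w = k] `&` (@st_Z _ _ q) t @^-1` B) =
   normal_prob (sgnb R (s k) * Delta)%R 1%R B *
   st_P q (s j0) (F `&` [set w | A t w = k]))%E.
  move=> HF mB; have [<-|jk] := eqVneq j0 k.
    apply: lawZ => //; apply: (Hm_sub t).
    by apply: (sigma_setI (sHm t)).
  rewrite (_ : [set w | A t w = k] = set0); first by rewrite setI0 set0I measure0 mule0.
  by apply/seteqP; split => // w /= E; move: jk; rewrite -E eqxx.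
have tau_stop : stopping_time (histm (@st_U _ _ q) A (@st_Z _ _ q)) tau.
  by move=> n; exact: (sigma_cst (sHm n) (le_time (Some 0%N) n)).
have tau_fin s : {ae st_P q (s j0), forall w, tau w <> None}.
  exact: nearW.
have dec_none (j : 'I_m) w : tau w = None -> (fun _ _ => true) j w by [].
have dec_stop0 (j : 'I_m) n : histm (@st_U _ _ q) A (@st_Z _ _ q) n
  ([set w | (fun _ _ => true) j w = false] `&` [set w | tau w = Some n]).
  rewrite (_ : _ `&` _ = set0); first exact: (sigma_set0 (sHm n)).
  by apply/seteqP; split => // w [].
exists (procedure_of_decisions (P := fun s => st_P q (s j0)) mU mZ
  (fun s s' => @lawU (s j0) (s' j0)) ruleA armA tau_stop tau_fin dec_none dec_stop0).
split => // s; rewrite big_pred0//= /mean_time.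
by under eq_integral do rewrite /= ; rewrite integral0.
Qed.

Lemma next_stage k : (k < m)%N -> staged k -> staged k.+1.
Proof.
move=> km [p [err cost]]; pose j0 := Ordinal km.
pose dec1 j w := pp_d p j (pp_S p w).
have arm1 s t F B k' : histm (@pp_U _ _ _ p) (@pp_A _ _ _ p) (@pp_Y _ _ _ p) t F ->
  measurable B ->
  (pp_P p s (F `&` [set w | @pp_A _ _ _ p t w = k'] `&` @pp_Y _ _ _ p t @^-1` B) =
   normal_prob (sgnb R (s k') * Delta)%R 1%R B *
   pp_P p s (F `&` [set w | @pp_A _ _ _ p t w = k']))%E.
  apply: (arm_of_integral_law (law := fun k => normal_prob (sgnb R (s k) * Delta) 1)).
  - exact: histm_sigma.
  - exact: (histm_measurable (@pp_mU _ _ _ p) (@pp_mY _ _ _ p) (@pp_rule _ _ _ p)).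
  - exact: (@pp_rule _ _ _ p).
  - exact: (@pp_lawY _ _ _ p).
have dec_stop1 j n : histm (@pp_U _ _ _ p) (@pp_A _ _ _ p) (@pp_Y _ _ _ p) n
  ([set w | dec1 j w = false] `&` [set w | pp_tau p w = Some n]).
  have [_ /(_ n) Hn] := stopped_decoder p j false.
  rewrite (_ : _ `&` _ = [set w | dec1 j w = false] `&`
    [set w | le_time (pp_tau p w) n] `&` [set w | pp_tau p w = Some n]).
    apply: (sigma_setI (histm_sigma _ _ _ _)) => //.
    by apply: (stopped_at _ _ (@pp_stop _ _ _ p)) => i;
      [exact: histm_sigma|exact: histm_le].
  by apply/seteqP; split => w /=; [case=> -> ->; rewrite /= leqnn|case=> -[-> _] ->].
pose p' := join_procedure (@pp_mU _ _ _ p) (@pp_mY _ _ _ p) (@pp_lawU _ _ _ p)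
  (@pp_rule _ _ _ p) arm1 (@pp_stop _ _ _ p) (@pp_fin _ _ _ p) dec_stop1
  mU mZ lawU lawZ (@st_stop _ _ q) nu_fin dec_stop j0.
exists p'; split.
- move=> s j; rewrite ltnS => jk.
  apply: le_trans (join_error (@pp_mU _ _ _ p) (@pp_mY _ _ _ p)
    (@pp_rule _ _ _ p) (@pp_stop _ _ _ p) (@pp_fin _ _ _ p)
    mU mZ (@st_stop _ _ q) nu_fin j0 (@measurable_decoder _ _ _ p) mdec s j) _.
  case: eqP => [_|/eqP nj]; first exact: q_error.
  by apply: err; rewrite ltn_neqAle jk andbT.
- move=> s; apply: etrans (join_mean (pp_P p) (@pp_mU _ _ _ p) (@pp_mY _ _ _ p)
    (@pp_rule _ _ _ p) (@pp_stop _ _ _ p) (st_P q) mU mZ (@st_stop _ _ q) j0 s) _.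
  rewrite cost.
  rewrite [RHS](bigD1 j0)/= ?ltnS//= addeC; congr (_ + _)%E.
  apply: eq_bigl => j; rewrite ltnS ltn_neqAle andbC; congr (_ && _).
Qed.

Lemma sequential_procedure : (0 < m)%N ->
  exists2 p : procedure m Delta, coordinatewise_correct alpha p &
    costm p = (m%:R%:E * cost1 q)%E.
Proof.
move=> m0.
have stages k : (k <= m)%N -> staged k.
  elim: k => [_|k ih km]; first exact: (first_stage (Ordinal m0)).
  by apply: next_stage => //; apply: ih; exact: ltnW.
have [p [err cost]] := stages _ (leqnn m).
exists p.
  by move=> j; apply: ge_ereal_sup => _ [s _ <-]; exact: err.
rewrite /costm; under eq_bigr do rewrite cost.
rewrite (eq_bigr (fun s : {ffun 'I_m -> bool} =>
    \sum_(j < m) mean_time (st_P q (s j)) (st_nu q))%E); last first.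
  by move=> s _; apply: eq_bigl => j; rewrite ltn_ord.
have m0' b := mean_time_ge0 (st_P q b) (st_nu q).
have c0 := cost1_ge0 q.
(* Pairing the sign vectors that differ in coordinate [j] yields [cost1 q] for each of the [2 ^ m]
   vectors. *)
rewrite exchange_big /= (eq_bigr (fun=> (2 ^+ m)%:E * cost1 q)%E); last first.
  move=> j _; rewrite (@sum_signs_average _ _ j)//.
  rewrite (eq_bigr (fun=> cost1 q)); last by move=> s _; rewrite !ffunE eqxx.
  by rewrite sume_const// card_ffun card_bool card_ord natrX.
rewrite sume_const ?card_ord; last by rewrite mule_ge0// lee_fin exprn_ge0.
rewrite muleCA; congr (_ * _)%E.
by rewrite muleA -EFinM mulVf ?mul1e// expf_neq0.
Qed.

End sequential_procedure.

Theorem theorem3 (R : realType) (Delta alpha : R)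
    (hDelta : 0 < Delta) (halpha : 0 < alpha < 2^-1) (m : nat)
    (hm : (1 <= m)%N) :
  Cpost m alpha Delta = (m%:R%:E * C1 alpha Delta)%E.
Proof.
have m0 : (0 : R) < m%:R by rewrite ltr0n.
apply/eqP; rewrite eq_le; apply/andP; split; last first.
  by apply/ereal_infP => _ [p [corr ->]]; exact: costm_lower.
(* Dividing by [m] frees the infimum of its factor, so each test can be treated separately. *)
rewrite -lee_pdivrMl//; apply/ereal_infP => _ [q [corr ->]].
rewrite lee_pdivrMl//.
(* A test of infinite cost may fail to stop, but the bound is then trivial. *)
have [fin|] := ltP (cost1 q) +oo%E; last first.
  by rewrite leye_eq => /eqP ->; rewrite gt0_muley ?lte_fin// leey.
have [p corrp <-] := sequential_procedure corr fin hm.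
by apply: ereal_inf_lbound; exists p.
Qed.
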